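(* Let $A$ and $B$ be unital complex Banach algebras, and let $\Phi\colon A\to B$ be a surjective additive mapping satisfying $[\Phi(x^2),\Phi(x)]=0$ for each $x\in A$. Suppose that neither $A$ nor $B$ has a quotient isomorphic to $\mathbb{C}$ or $M_2(\mathbb{C})$, and further suppose that $B$ is semisimple. Then there exist a surjective Jordan homomorphism $\Psi\colon A\to B$, an invertible element $\lambda\in\mathcal{Z}(B)$, and an additive mapping $\zeta\colon A\to\mathcal{Z}(B)$ such that \[ \Phi(x)=\lambda\Psi(x)+\zeta(x)\quad\text{for all } x\in A. \] Furthermore, $\Psi$ is the direct sum of a homomorphism and an anti-homomorphism.
   Context: Notation: $[x,y]=xy-yx$, $x\circ y=xy+yx$, and $\mathcal{Z}(B)$ is the center of $B$. Mappings are additive, not necessarily linear. A Jordan homomorphism is an additive (not necessarily linear) mapping $\Psi\colon A\to B$ with $\Psi(x\circ y)=\Psi(x)\circ\Psi(y)$ for all $x,y\in A$. A mapping $\Psi\colon A\to B$ is the direct sum of a homomorphism and an anti-homomorphism if there exists a central idempotent $e\in B$ such that $e\Psi(xy)=e\Psi(x)\Psi(y)$ and $(1-e)\Psi(xy)=(1-e)\Psi(y)\Psi(x)$ for all $x,y\in A$. A quotient of an algebra is a quotient by a two-sided ideal, and isomorphisms of quotients are isomorphisms of complex algebras. Semisimple means that the Jacobson radical is zero. *)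

(* Defs.v *)
From HB Require Import structures.
From mathcomp Require Import all_boot all_order all_algebra.
From mathcomp Require Import generic_quotient ring_quotient complex.
From mathcomp Require Import boolp classical_sets reals topology normedtype.

Set Implicit Arguments.
Unset Strict Implicit.
Unset Printing Implicit Defensive.

Import GRing.Theory Num.Theory.
Import numFieldNormedType.Exports.

Local Open Scope classical_set_scope.
Local Open Scope ring_scope.

(* The library declares [Num.NumDomain] as the only join of its ring and norm
   structures, so no new structure can inherit from both. Hence the product is
   added here to a complete normed module, and the underlying algebra is the
   alias [algOf A], which has the same zero, addition and scaling as [A] but
   no norm. The unit is nonzero, as in any [algType]; its norm need not be 1. *)
HB.mixin Record isBanachAlgebra (K : numFieldType) (A : Type)
    of CompleteNormedModule K A := {
  bone : A;
  bmul : A -> A -> A;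
  bmulA : associative bmul;
  bmul1x : left_id bone bmul;
  bmulx1 : right_id bone bmul;
  bmulDl : left_distributive bmul +%R;
  bmulDr : right_distributive bmul +%R;
  bone_neq0 : bone != 0;
  bscaleAl : forall (k : K) (x y : A), k *: bmul x y = bmul (k *: x) y;
  bscaleAr : forall (k : K) (x y : A), k *: bmul x y = bmul x (k *: y);
  norm_bmul : forall x y : A, `|bmul x y| <= `|x| * `|y|
}.

#[short(type="banachAlgType")]
HB.structure Definition BanachAlgebra (K : numFieldType) :=
  {A of CompleteNormedModule K A & isBanachAlgebra K A}.

Definition algOf (K : numFieldType) (A : banachAlgType K) : Type := A.

Section AlgOf.
Variables (K : numFieldType) (A : banachAlgType K).

HB.instance Definition _ := GRing.Lmodule.copy (algOf A) A.
HB.instance Definition _ := GRing.Zmodule_isNzRing.Build (algOf A)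
  (@bmulA K A) (@bmul1x K A) (@bmulx1 K A) (@bmulDl K A) (@bmulDr K A)
  (@bone_neq0 K A).
HB.instance Definition _ := GRing.Lmodule_isLalgebra.Build K (algOf A)
  (@bscaleAl K A).
HB.instance Definition _ := GRing.Lalgebra_isAlgebra.Build K (algOf A)
  (@bscaleAr K A).

End AlgOf.

(* Not required to be proper, unlike [idealr]. *)
HB.mixin Record isTwoSidedIdeal (A : nzRingType) (I : A -> bool) := {
  tideal_mull : forall a x : A, x \in I -> a * x \in I;
  tideal_mulr : forall a x : A, x \in I -> x * a \in I
}.

#[short(type="tideal")]
HB.structure Definition TwoSidedIdeal (A : nzRingType) :=
  {I of GRing.ZmodClosed A I & isTwoSidedIdeal A I}.

(* The library gives [{ideal_quot I}] its additive group for any additive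
   subgroup [I], but a ring structure only over a commutative ring. Since [I]
   may be the whole algebra, the quotient is only a [pzRingType], hence not
   an instance of [algType]. *)
Section AlgQuotient.
Variables (K : pzRingType) (A : algType K) (I : tideal A).

Definition alg_quot := {ideal_quot I}.
Local Notation Q := alg_quot.

HB.instance Definition _ := GRing.Zmodule.on Q.

Local Notation pi := (\pi_({ideal_quot I})%qT : A -> Q).

Definition qone : Q := pi 1.
Definition qmul (u v : Q) : Q := pi (repr u * repr v).
Definition qscale (k : K) (u : Q) : Q := pi (k *: repr u).

Lemma alg_quot_piP (x y : A) : pi x = pi y <-> x - y \in I.
Proof.
by rewrite Quotient.idealrBE; split=> /eqP.
Qed.

Lemma alg_quot_repr (x : A) : repr (pi x) - x \in I.
Proof. by apply/alg_quot_piP; rewrite reprK. Qed.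

Lemma alg_quotW (P : Q -> Prop) : (forall x, P (pi x)) -> forall u, P u.
Proof. by move=> h u; rewrite -[u]reprK; apply: h. Qed.

Lemma pi_qadd (x y : A) : pi (x + y) = pi x + pi y.
Proof. exact: (@pi_addr _ _ _ _ _ {ideal_quot I}). Qed.

Lemma pi_qmul (x y : A) : qmul (pi x) (pi y) = pi (x * y).
Proof.
apply/alg_quot_piP; have hx := alg_quot_repr x; have hy := alg_quot_repr y.
have -> : repr (pi x) * repr (pi y) - x * y
    = (repr (pi x) - x) * repr (pi y) + x * (repr (pi y) - y).
  by rewrite mulrBl mulrBr addrA subrK.
by apply: rpredD; [apply: tideal_mulr | apply: tideal_mull].
Qed.

Lemma pi_qscale (k : K) (x : A) : qscale k (pi x) = pi (k *: x).
Proof.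
apply/alg_quot_piP; rewrite -scalerBr -mulr_algl.
by apply: tideal_mull; apply: alg_quot_repr.
Qed.

Lemma qmulA : associative qmul.
Proof.
by elim/alg_quotW=> x; elim/alg_quotW=> y; elim/alg_quotW=> z;
  rewrite !pi_qmul mulrA.
Qed.

Lemma qmul1 : left_id qone qmul.
Proof. by elim/alg_quotW=> x; rewrite pi_qmul mul1r. Qed.

Lemma qmulr1 : right_id qone qmul.
Proof. by elim/alg_quotW=> x; rewrite pi_qmul mulr1. Qed.

Lemma qmulDl : left_distributive qmul +%R.
Proof.
by elim/alg_quotW=> x; elim/alg_quotW=> y; elim/alg_quotW=> z;
  rewrite -pi_qadd !pi_qmul -pi_qadd mulrDl.
Qed.

Lemma qmulDr : right_distributive qmul +%R.
Proof.
by elim/alg_quotW=> x; elim/alg_quotW=> y; elim/alg_quotW=> z;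
  rewrite -pi_qadd !pi_qmul -pi_qadd mulrDr.
Qed.

HB.instance Definition _ := GRing.Zmodule_isPzRing.Build Q
  qmulA qmul1 qmulr1 qmulDl qmulDr.

Lemma qscaleA (a b : K) (u : Q) : qscale a (qscale b u) = qscale (a * b) u.
Proof. by elim/alg_quotW: u => x; rewrite !pi_qscale scalerA. Qed.

Lemma qscale1 : left_id 1 qscale.
Proof. by elim/alg_quotW=> x; rewrite pi_qscale scale1r. Qed.

Lemma qscaleDr : right_distributive qscale +%R.
Proof.
by move=> a; elim/alg_quotW=> x; elim/alg_quotW=> y;
  rewrite -pi_qadd !pi_qscale -pi_qadd scalerDr.
Qed.

Lemma qscaleDl (u : Q) : {morph qscale^~ u : a b / a + b}.
Proof.
by elim/alg_quotW: u => x a b; rewrite !pi_qscale -pi_qadd scalerDl.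
Qed.

HB.instance Definition _ := GRing.Zmodule_isLmodule.Build K Q
  qscaleA qscale1 qscaleDr qscaleDl.

End AlgQuotient.

Definition has_quotient_iso (K : pzRingType) (A S : algType K) : Prop :=
  exists (I : tideal A) (f : {linear alg_quot I -> S}),
    monoid_morphism f /\ bijective f.

Section Rings.
Variable A : nzRingType.

Definition commutator (x y : A) : A := x * y - y * x.

Definition jordan_prod (x y : A) : A := x * y + y * x.

Definition ring_center : set A := [set z | forall x, z * x = x * z].

Definition left_ideal (L : set A) : Prop :=
  [/\ L 0, forall x y, L x -> L y -> L (x + y)
    & forall a x, L x -> L (a * x)].

Definition maximal_left_ideal (M : set A) : Prop :=
  [/\ left_ideal M, M != setT
    & forall L, left_ideal L -> M `<=` L -> L = M \/ L = setT].

Definition jacobson_radical : set A :=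
  \bigcap_(M in maximal_left_ideal) M.

Definition semisimple : Prop := jacobson_radical = [set 0].

End Rings.

Definition jordan_homomorphism (A B : nzRingType) (f : A -> B) : Prop :=
  {morph f : x y / x + y} /\
  {morph f : x y / jordan_prod x y}.

Definition direct_sum_hom_antihom (A B : nzRingType) (f : A -> B) : Prop :=
  exists e : B, [/\ ring_center e, e * e = e,
    forall x y, e * f (x * y) = e * f x * f y
    & forall x y, (1 - e) * f (x * y) = (1 - e) * f y * f x].

(* Main.v *)
Require Import Defs.
From HB Require Import structures.
From mathcomp Require Import all_boot all_order all_algebra.
From mathcomp Require Import generic_quotient ring_quotient complex.
From mathcomp Require Import boolp classical_sets reals topology normedtype.
From mathcomp Require Import sequences derive.
From mathcomp Require Import ring lra.

Set Implicit Arguments.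
Unset Strict Implicit.
Unset Printing Implicit Defensive.

Import Order.TTheory GRing.Theory Num.Theory.
Import numFieldNormedType.Exports.
Local Open Scope ring_scope.

(** Modulo the center, Phi is a Jordan homomorphism up to a factor. The
    polarized hypothesis is a functional identity in three variables for
    T x y = Phi (x y + y x), namely that the cyclic sum of the [T x y, Phi z]
    vanishes, and the first task is to solve it inside B.

    The assumption on the quotients of B enters as follows. For t in B the
    element [t^2, w] u [t, v] - [t, w] u [t^2, v] is the value at t^2 of a map
    z |-> sum a_i z b_i that annihilates 1 and t. In a simple algebra all of
    these elements vanish only if every t is quadratic over the center, and
    then the algebra has dimension one or four over its center
    ([quadratic_simple_ring]). The center of a simple quotient of a unital
    complex Banach algebra consists of the complex numbers, by a form of the
    Gelfand-Mazur theorem that needs only Neumann series and a maximum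
    principle for resolvents ([simple_quotient_center]). Hence the elements
    above generate B as an ideal ([banach_defects_generate]). With such maps
    one extracts the coefficient of t^2 from an expression of degree two in t,
    so functional identities in three variables have only the obvious
    solutions ([fi_two_sided3], [fi_one_sided3]). It follows that

      Phi (x y + y x) = l (Phi x Phi y + Phi y Phi x)
                          + mu x Phi y + mu y Phi x + central

    with l central and mu additive with central values ([commuting_form]).

    The factor l is invertible. Otherwise l vanishes in a simple quotient of B,
    and there Phi behaves like the identity of the Jordan algebra of a
    quadratic form, with trace mu. The elements of A that are degenerate for
    this form are a proper Jordan ideal, and modulo a maximal two-sided ideal
    that contains it the squares of double commutators of A are central
    ([degenerate_identity]). A simple quotient of A with this property has
    dimension one or four ([double_commutator_simple_ring]), against the
    hypothesis.

    Now Psi = l Phi + mu / 2 satisfies the Jordan identity up to a central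
    error, the associativity of A makes this error annihilate all the defects
    of B ([eps_zero]), and so Psi is a Jordan homomorphism. Semisimplicity is
    used in the form that B is semiprime. For such B the defects
    Psi (x y) - Psi x Psi y and Psi (x y) - Psi y Psi x generate ideals that
    annihilate each other ([defects_orthogonal]). The sum of these ideals
    contains all commutators and hence 1, and the components of 1 are the
    central idempotents e and 1 - e ([jordan_direct_sum]). Since Psi is onto
    modulo the center, and commutators generate B, it is onto
    ([direct_sum_half_surj]). *)

(** * Identities in free rings *)

(** Formal expressions over noncommuting letters. Two expressions that agree
    as polynomials in the free ring over the integers agree under every
    evaluation, and the tactic [ncring] decides the former by computation. *)
Inductive ncexpr :=
| NCvar of nat | NC0 | NC1
| NCadd of ncexpr & ncexpr | NCopp of ncexpr | NCmul of ncexpr & ncexpr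
| NCmuln of ncexpr & nat | NCexp of ncexpr & nat.

Definition ncpoly := seq (seq nat * int).

(** Monomials whose coefficient vanishes are dropped on the fly, so that every
    identity of free rings normalizes to the empty list, without any ordering
    of the monomials. *)
Fixpoint nc_add_term (w : seq nat) (c : int) (p : ncpoly) : ncpoly :=
  if p is (w', c') :: p' then
    if w == w' then (if c + c' == 0 then p' else (w, c + c') :: p')
    else (w', c') :: nc_add_term w c p'
  else [:: (w, c)].

Definition nc_add (p q : ncpoly) : ncpoly :=
  foldr (fun m r => nc_add_term m.1 m.2 r) q p.

Definition nc_scale (k : int) (p : ncpoly) : ncpoly :=
  [seq (m.1, k * m.2) | m <- p].

Definition nc_mul (p q : ncpoly) : ncpoly :=
  foldr (fun m r => nc_add [seq (m.1 ++ m'.1, m.2 * m'.2) | m' <- q] r) [::] p.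

Fixpoint nc_norm (e : ncexpr) : ncpoly :=
  match e with
  | NCvar i => [:: ([:: i], 1)]
  | NC0 => [::]
  | NC1 => [:: ([::], 1)]
  | NCadd a b => nc_add (nc_norm a) (nc_norm b)
  | NCopp a => nc_scale (-1) (nc_norm a)
  | NCmul a b => nc_mul (nc_norm a) (nc_norm b)
  | NCmuln a n => nc_scale n (nc_norm a)
  | NCexp a n => iter n (nc_mul (nc_norm a)) [:: ([::], 1)]
  end.

Section NcEval.
Variables (R : pzRingType) (env : seq R).

Fixpoint nc_eval (e : ncexpr) : R :=
  match e with
  | NCvar i => nth 0 env i
  | NC0 => 0
  | NC1 => 1
  | NCadd a b => nc_eval a + nc_eval b
  | NCopp a => - nc_eval a
  | NCmul a b => nc_eval a * nc_eval b
  | NCmuln a n => nc_eval a *+ n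
  | NCexp a n => nc_eval a ^+ n
  end.

Definition nc_word (w : seq nat) : R := \prod_(i <- w) nth 0 env i.

Definition nc_value (p : ncpoly) : R := \sum_(m <- p) nc_word m.1 *~ m.2.

Lemma nc_value_add_term w c p :
  nc_value (nc_add_term w c p) = nc_word w *~ c + nc_value p.
Proof.
elim: p => [|[w' c'] p ih] /=; first by rewrite /nc_value big_seq1 big_nil addr0.
rewrite {2}/nc_value big_cons /=.
case: eqVneq => [<-|_]; last by rewrite {1}/nc_value big_cons /= -/(nc_value _) ih addrCA.
rewrite addrA -mulrzDr; case: eqP => [->|_]; first by rewrite mulr0z add0r.
by rewrite /nc_value big_cons.
Qed.

Lemma nc_value_add p q : nc_value (nc_add p q) = nc_value p + nc_value q.
Proof.
elim: p => [|m p ih] /=; first by rewrite {2}/nc_value big_nil add0r.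
by rewrite nc_value_add_term ih {3}/nc_value big_cons addrA.
Qed.

Lemma nc_value_scale k p : nc_value (nc_scale k p) = nc_value p *~ k.
Proof.
rewrite /nc_value big_map /= mulrz_suml; apply: eq_bigr => m _.
by rewrite mulrC mulrzA.
Qed.

Lemma nc_value_mul p q : nc_value (nc_mul p q) = nc_value p * nc_value q.
Proof.
elim: p => [|m p ih] /=; first by rewrite {1 2}/nc_value !big_nil mul0r.
rewrite nc_value_add ih [nc_value (m :: p)]big_cons mulrDl; congr (_ + _).
rewrite /nc_value big_map /= mulr_sumr; apply: eq_bigr => m' _.
by rewrite /nc_word big_cat /= mulrzAl mulrzAr -mulrzA [m.2 * _]mulrC.
Qed.

Lemma nc_normE e : nc_value (nc_norm e) = nc_eval e.
Proof.
elim: e => [i|||a iha b ihb|a iha|a iha b ihb|a iha n|a iha n] /=.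
- by rewrite /nc_value /nc_word !big_seq1.
- by rewrite /nc_value big_nil.
- by rewrite /nc_value /nc_word big_seq1 big_nil.
- by rewrite nc_value_add iha ihb.
- by rewrite nc_value_scale iha mulrN1z.
- by rewrite nc_value_mul iha ihb.
- by rewrite nc_value_scale iha.
elim: n => [|n ih] /=; first by rewrite /nc_value /nc_word big_seq1 big_nil.
by rewrite nc_value_mul ih iha exprS.
Qed.

Lemma nc_eqP a b : nc_norm (NCadd a (NCopp b)) = [::] -> nc_eval a = nc_eval b.
Proof.
move=> h; apply/eqP; rewrite -subr_eq0; apply/eqP.
by rewrite -[LHS]/(nc_eval (NCadd a (NCopp b))) -nc_normE h /nc_value big_nil.
Qed.
End NcEval.

(** Letters are compared up to conversion, because the same element may be
    displayed through different paths of canonical structures. *)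
Ltac nc_index x env :=
  lazymatch env with
  | ?y :: ?env' =>
    match constr:(tt) with
    | _ => let _ := match constr:(tt) with _ => constr_eq x y end in constr:(O)
    | _ => let _ := match constr:(tt) with _ => unify x y end in constr:(O)
    | _ => let n := nc_index x env' in constr:(S n)
    end
  end.
Ltac nc_mem x env :=
  lazymatch env with
  | ?y :: ?env' =>
    match constr:(tt) with
    | _ => let _ := match constr:(tt) with _ => constr_eq x y end in constr:(true)
    | _ => let _ := match constr:(tt) with _ => unify x y end in constr:(true)
    | _ => nc_mem x env'
    end
  | _ => constr:(false)
  end.
(** Only literal exponents are expanded; powers and multiples by a variable
    are letters. *)
Ltac nc_numeral n :=
  lazymatch n with O => constr:(true) | S ?m => nc_numeral m | _ => constr:(false) end.
Ltac nc_insert t env :=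
  let m := nc_mem t env in
  lazymatch m with true => env | false => constr:(t :: env) end.
Ltac nc_atoms t env :=
  lazymatch t with
  | 0%R => env
  | 1%R => env
  | (?a + ?b)%R => let e := nc_atoms a env in nc_atoms b e
  | (- ?a)%R => nc_atoms a env
  | (?a * ?b)%R => let e := nc_atoms a env in nc_atoms b e
  | (?a *+ ?n)%R => let c := nc_numeral n in
      lazymatch c with true => nc_atoms a env | false => nc_insert t env end
  | (?a ^+ ?n)%R => let c := nc_numeral n in
      lazymatch c with true => nc_atoms a env | false => nc_insert t env end
  | _ => nc_insert t env
  end.
Ltac nc_reify t env :=
  lazymatch t with
  | 0%R => constr:(NC0)
  | 1%R => constr:(NC1)
  | (?a + ?b)%R => let x := nc_reify a env in let y := nc_reify b env in constr:(NCadd x y)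
  | (- ?a)%R => let x := nc_reify a env in constr:(NCopp x)
  | (?a * ?b)%R => let x := nc_reify a env in let y := nc_reify b env in constr:(NCmul x y)
  | (?a *+ ?n)%R => let c := nc_numeral n in
      lazymatch c with
      | true => let x := nc_reify a env in constr:(NCmuln x n)
      | false => let i := nc_index t env in constr:(NCvar i)
      end
  | (?a ^+ ?n)%R => let c := nc_numeral n in
      lazymatch c with
      | true => let x := nc_reify a env in constr:(NCexp x n)
      | false => let i := nc_index t env in constr:(NCvar i)
      end
  | _ => let n := nc_index t env in constr:(NCvar n)
  end.
Ltac ncring :=
  lazymatch goal with
  | |- @eq ?T ?a ?b =>
    let env := nc_atoms a (@nil T) in
    let env := nc_atoms b env in
    let x := nc_reify a env in
    let y := nc_reify b env in
    refine (@nc_eqP _ env x y _); vm_compute; reflexivity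
  end.

(** * Two-sided ideals, centers and simple rings *)

(** Reduces a goal to the statement that the difference of its sides is a
    combination of known relations: repeated uses accumulate the combination,
    and [ncring] then checks it. *)
Lemma use_eq (R : pzRingType) (l r a b x y : R) :
  a = b -> x = y + l * (a - b) * r -> x = y.
Proof. by move=> -> ->; rewrite subrr mulr0 mul0r addr0. Qed.
Arguments use_eq {R} l r {a b x y}.

Notation lie x y := (x * y - y * x).
Notation jord x y := (x * y + y * x).

Section TwoSided.
Variable R : pzRingType.
Implicit Types (I S : R -> Prop) (x y z : R).

Definition two_sided I : Prop :=
  [/\ I 0, forall x y, I x -> I y -> I (x + y)
    & forall a x b, I x -> I (a * x * b)].

(** The two-sided ideal generated by [S] is the whole ring. Quantifying over
    ideals avoids writing the unit as a finite sum: a property is transferred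
    to the unit by checking that it defines an ideal. *)
Definition generates_unit S : Prop :=
  forall I, two_sided I -> (forall x, S x -> I x) -> I 1.

Definition central z : Prop := forall x, z * x = x * z.

Definition semiprime : Prop := forall a : R, (forall b, a * b * a = 0) -> a = 0.

Definition simple_ring : Prop :=
  1 <> 0 :> R /\ forall x, x <> 0 -> generates_unit (eq x).

Lemma two_sided_mull I a x : two_sided I -> I x -> I (a * x).
Proof. by case=> _ _ h /(h a x 1); rewrite mulr1. Qed.

Lemma two_sided_mulr I a x : two_sided I -> I x -> I (x * a).
Proof. by case=> _ _ h /(h 1 x a); rewrite mul1r. Qed.

Lemma two_sided_opp I x : two_sided I -> I x -> I (- x).
Proof. by move=> hI /(two_sided_mull (-1) hI); rewrite mulN1r. Qed.

Lemma two_sided_sub I x y : two_sided I -> I x -> I y -> I (x - y).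
Proof. by move=> hI hx /(two_sided_opp hI); case: hI => _ hD _; apply: hD. Qed.

Lemma central0 : central 0. Proof. by move=> x; rewrite mul0r mulr0. Qed.
Lemma central1 : central 1. Proof. by move=> x; rewrite mul1r mulr1. Qed.
Lemma centralD x y : central x -> central y -> central (x + y).
Proof. by move=> hx hy z; rewrite mulrDl mulrDr hx hy. Qed.
Lemma centralN x : central x -> central (- x).
Proof. by move=> hx z; rewrite mulNr mulrN hx. Qed.
Lemma centralB x y : central x -> central y -> central (x - y).
Proof. by move=> hx hy; apply/centralD/centralN. Qed.
Lemma centralM x y : central x -> central y -> central (x * y).
Proof. by move=> hx hy z; rewrite -mulrA hy mulrA hx mulrA. Qed.
Lemma centralMn x n : central x -> central (x *+ n).
Proof. by move=> hx y; rewrite mulrnAl mulrnAr hx. Qed.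
Lemma central_inverse x y : central x -> x * y = 1 -> central y.
Proof.
move=> hx xy z.
apply: (use_eq (- (y * z)) (1) xy).
apply: (use_eq (- y) (y) (hx z)).
apply: (use_eq (-1) (z * y) (hx y)).
apply: (use_eq (1) (z * y) xy).
ncring.
Qed.

Section Simple.
Hypothesis sR : simple_ring.

Lemma simple_prime x y : (forall b, x * b * y = 0) -> x <> 0 -> y = 0.
Proof.
move=> h /(proj2 sR)/(_ (fun z => forall b, z * b * y = 0)) h1.
rewrite -[y]mul1r -[1]mulr1; apply: h1 => [|z <-//].
split=> [b|u v hu hv b|a u c hu b]; first by rewrite !mul0r.
  by rewrite !mulrDl hu hv addr0.
by apply: (use_eq (a) (1) (hu (c * b))); ncring.
Qed.

Lemma simple_semiprime : semiprime.
Proof.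
by move=> a h; case: (pselect (a = 0)) => // /(simple_prime h).
Qed.

Lemma simple_central_unit z : central z -> z <> 0 -> exists w, z * w = 1.
Proof.
move=> cz /(proj2 sR)/(_ (fun x => exists w, z * w = x)); apply; last first.
  by move=> _ <-; exists 1; rewrite mulr1.
split; first by exists 0; rewrite mulr0.
  by move=> _ _ [u <-] [v <-]; exists (u + v); rewrite mulrDr.
by move=> a _ b [u <-]; exists (a * u * b); rewrite !mulrA cz.
Qed.

(** Martindale's lemma. The relation says that the assignment sending a sum of
    products a g b to the sum of the a h b is well defined, and it is
    multiplication by its value at the unit. *)
Lemma simple_proportional g h :
  (forall y, h * y * g = g * y * h) -> g <> 0 ->
  exists2 a, central a & h = a * g.
Proof.
move=> hg g0.
have [a ha] : exists a, forall y, a * y * g = 1 * y * h.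
  apply: (proj2 sR) g0 (fun x => exists a, forall y, a * y * g = x * y * h) _ _.
    split; first by exists 0 => y; rewrite !mul0r.
      move=> x y [a ha] [b hb]; exists (a + b) => z.
      by rewrite !mulrDl ha hb.
    move=> c x d [a ha]; exists (c * a * d) => y.
    by have := ha (d * y); rewrite -!mulrA => ->.
  by move=> _ <-; exists h.
exists a; last by have := ha 1; rewrite !mulr1 mul1r.
move=> y; apply/eqP; rewrite -subr_eq0; apply/eqP.
case: (pselect (a * y - y * a = 0)) => // /(@simple_prime _ g) h1.
case: g0; apply: h1 => b.
apply: (use_eq 1 1 (ha (y * b))).
apply: (use_eq (- y) 1 (ha b)).
ncring.
Qed.

End Simple.

(** The map z |-> [z, w] u [t, v] - [t, w] u [z, v] annihilates 1 and t, and
    this is its value at t^2; it therefore detects that 1, t, t^2 are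
    independent over the center. *)
Definition quad_defect (t w u v : R) : R :=
  lie (t * t) w * u * lie t v - lie t w * u * lie (t * t) v.

Definition is_quad_defect (x : R) : Prop :=
  exists t w u v, x = quad_defect t w u v.

(** If w does not commute with t, then the vanishing of the defects makes
    [t^2, w] proportional to [t, w] by a central factor a. The same factor
    serves for every other commutator, so t^2 - a t is central. *)
Lemma quad_defect0 t : simple_ring ->
  (forall w u v, quad_defect t w u v = 0) ->
  central t \/ exists a b, [/\ central a, central b & t * t = a * t + b].
Proof.
move=> sR h; case: (pselect (central t)) => [|nc]; [by left | right].
have [w hw] : exists w, lie t w <> 0.
  apply: contrapT => hn; apply: nc => w; apply: contrapT => hw; apply: hn.
  by exists w => /eqP; rewrite subr_eq0 => /eqP.
have [a ca ha] : exists2 a, central a & lie (t * t) w = a * lie t w.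
  apply: simple_proportional => // y; apply/eqP; rewrite -subr_eq0.
  by rewrite [X in X == _](h w y w).
exists a, (t * t - a * t); split=> //; last by rewrite addrC subrK.
move=> v; apply/eqP; rewrite -subr_eq0; apply/eqP.
apply: (simple_prime sR (x := lie t w)) => // b.
apply: (use_eq (-1) 1 (h w b v)).
apply: (use_eq 1 (b * lie t v) ha).
apply: (use_eq 1 (b * lie t v) (ca (lie t w))).
apply: (use_eq (lie t w) (lie t v) (ca b)).
apply: (use_eq (- (lie t w * b)) t (ca v)).
rewrite /quad_defect.
ncring.
Qed.

End TwoSided.

(** * Simple algebras of dimension one and four *)

Section SimpleAlgebra.
Variables (F : numClosedFieldType) (R : pzRingType) (k : {rmorphism F -> R}).
Hypothesis sR : simple_ring R.
Hypothesis kC : forall c, central (k c).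

Definition scalar_ring : Prop := forall x : R, exists c, x = k c.

Definition matrix2_ring : Prop :=
  exists T : 'M[F]_2 -> R,
    [/\ {morph T : x y / x + y}, {morph T : x y / x * y}, T 1 = 1,
        forall c, T c%:M = k c & injective T /\ forall x, exists m, T m = x].

Lemma scalarD a b : k (a + b) = k a + k b. Proof. exact: rmorphD. Qed.
Lemma scalarB a b : k (a - b) = k a - k b. Proof. exact: rmorphB. Qed.
Lemma scalarM a b : k (a * b) = k a * k b. Proof. exact: rmorphM. Qed.
Lemma scalarN a : k (- a) = - k a. Proof. exact: rmorphN. Qed.
Lemma scalar0 : k 0 = 0. Proof. exact: rmorph0. Qed.
Lemma scalar1 : k 1 = 1. Proof. exact: rmorph1. Qed.

Lemma scalar_unit c : c != 0 -> k c^-1 * k c = 1.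
Proof. by move=> c0; rewrite -scalarM mulVf // scalar1. Qed.

Lemma scalar_reg c x : k c * x = 0 -> c = 0 \/ x = 0.
Proof.
case: (eqVneq c 0) => [|c0 h]; [by left | right].
by rewrite -[x]mul1r -(scalar_unit c0) -mulrA h mulr0.
Qed.

(** Since the ring is prime there are p in eRf and q in fRe with p q = e; then
    q p = f because the corner fRf consists of scalars, and e, p, q, f are
    matrix units. *)
Lemma matrix2_of_corners (e f : R) : e * e = e -> e + f = 1 ->
  e <> 0 -> f <> 0 ->
  (forall x, exists c, e * x * e = k c * e) ->
  (forall x, exists c, f * x * f = k c * f) -> matrix2_ring.
Proof.
move=> ee ef1 e0 f0 eRe fRf.
have fE : f = 1 - e by rewrite -ef1 addrAC subrr add0r.
have ef : e * f = 0 by rewrite fE mulrBr mulr1 ee subrr.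
have fe : f * e = 0 by rewrite fE mulrBl mul1r ee subrr.
have ff : f * f = f by rewrite {1}fE mulrBl mul1r ef subr0.
have [x hx] : exists x, e * x * f <> 0.
  apply: contrapT => hn; apply: f0; apply: (simple_prime sR _ e0) => b.
  by apply: contrapT => hb; apply: hn; exists b.
have [y hy] : exists y, (e * x * f) * y * e <> 0.
  apply: contrapT => hn; apply: e0; apply: (simple_prime sR _ hx) => b.
  by apply: contrapT => hb; apply: hn; exists b.
pose p := e * x * f.
have [c hc] : exists c, p * y * e = k c * e.
  by have [c hc] := eRe (x * f * y); exists c; rewrite -hc /p !mulrA.
have c0 : c != 0 by apply/eqP => c0; apply: hy; rewrite -/p hc c0 scalar0 mul0r.
pose q := k c^-1 * (f * y * e).
have ep : e * p = p by rewrite /p !mulrA ee.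
have pf : p * f = p by rewrite /p -!mulrA ff.
have pe : p * e = 0 by rewrite /p -!mulrA fe !mulr0.
have fp : f * p = 0 by rewrite /p !mulrA fe !mul0r.
have qe : q * e = q by rewrite /q -!mulrA ee.
have fq : f * q = q by rewrite /q !mulrA -kC -!mulrA [f * (f * _)]mulrA ff.
have eq : e * q = 0 by rewrite /q mulrA -kC -mulrA !mulrA -[_ * e * f]mulrA ef mulr0 !mul0r.
have qf : q * f = 0 by rewrite /q -!mulrA ef !mulr0.
have pq : p * q = e.
  have h : p * (f * y * e) = k c * e by rewrite !mulrA pf.
  by rewrite /q mulrA -kC -mulrA h mulrA scalar_unit // mul1r.
have p0 : p <> 0 by [].
clearbody p q.
have q0 : q <> 0 by move=> q0; apply: e0; rewrite -pq q0 mulr0.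
have qp : q * p = f.
  have [d hd] : exists d, q * p = k d * f.
    by have [d hd] := fRf (q * p); exists d; rewrite -hd !mulrA fq -mulrA pf.
  suff d1 : d = 1 by rewrite hd d1 scalar1 mul1r.
  have : k (1 - d) * p = 0.
    rewrite scalarB scalar1 mulrBl mul1r kC -[in p * _]pf -mulrA -kC -hd.
    by rewrite mulrA pq ep subrr.
  by case/scalar_reg => // /eqP; rewrite subr_eq0 => /eqP.
have qq : q * q = 0 by rewrite -{1}qe -mulrA eq mulr0.
have pp : p * p = 0 by rewrite -{1}pf -mulrA fp mulr0.
have tab := (ee, ef, fe, ff, ep, pf, pe, fp, qe, fq, eq, qf, pq, qp, qq, pp).
have kk a b u v : k a * u * (k b * v) = k (a * b) * (u * v).
  by rewrite scalarM -!mulrA; congr (_ * _); rewrite !mulrA kC.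
pose i0 : 'I_2 := ord0; pose i1 : 'I_2 := lift ord0 ord0.
pose T (m : 'M[F]_2) : R :=
  k (m i0 i0) * e + k (m i0 i1) * p + k (m i1 i0) * q + k (m i1 i1) * f.
have TD : {morph T : m n / m + n}.
  by move=> m n; rewrite /T !mxE !scalarD; ncring.
exists T; split=> //.
- move=> m n.
  have mE i j : (m * n) i j = m i i0 * n i0 j + m i i1 * n i1 j.
    by rewrite mxE !big_ord_recl big_ord0 addr0.
  rewrite /T !mE !scalarD !mulrDl !mulrDr !kk !tab !mulr0 !addr0 !add0r.
  rewrite !scalarM; ncring.
- by rewrite /T !mxE /= !scalar1 !scalar0 !mul0r !mul1r !addr0 ef1.
- by move=> c'; rewrite /T !mxE /= !scalar0 !mul0r !addr0 -mulrDr ef1 mulr1.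
split.
- have TN m : T (- m) = - T m.
    by rewrite /T !mxE !scalarN; ncring.
  move=> m n mn; apply/eqP; rewrite -subr_eq0; apply/eqP.
  have : T (m - n) = 0 by rewrite TD TN mn subrr.
  move: (m - n) => {mn}m {}n.
  have h1 : k (m i0 i0) * e = 0.
    have : e * T m * e = 0 by rewrite n mulr0 mul0r.
    rewrite /T !mulrDr !mulrDl ![e * (k _ * _)]mulrA -!kC.
    by rewrite -![k _ * e * _]mulrA -!mulrA !(tab, mulr0, addr0).
  have h2 : k (m i0 i1) * e = 0.
    have : e * T m * q = 0 by rewrite n mulr0 mul0r.
    rewrite /T !mulrDr !mulrDl ![e * (k _ * _)]mulrA -!kC.
    by rewrite -![k _ * e * _]mulrA -!mulrA !(tab, mulr0, addr0, add0r).
  have h3 : k (m i1 i0) * e = 0.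
    have : p * T m * e = 0 by rewrite n mulr0 mul0r.
    rewrite /T !mulrDr !mulrDl ![p * (k _ * _)]mulrA -!kC.
    by rewrite -![k _ * p * _]mulrA -!mulrA !(tab, mulr0, addr0, add0r).
  have h4 : k (m i1 i1) * e = 0.
    have : p * T m * q = 0 by rewrite n mulr0 mul0r.
    rewrite /T !mulrDr !mulrDl ![p * (k _ * _)]mulrA -!kC.
    by rewrite -![k _ * p * _]mulrA -!mulrA !(tab, mulr0, addr0, add0r).
  apply/matrixP => i j; rewrite mxE.
  case/scalar_reg: h1 => // h1; case/scalar_reg: h2 => // h2.
  case/scalar_reg: h3 => // h3; case/scalar_reg: h4 => // h4.
  have dec (l : 'I_2) : l = i0 \/ l = i1.
    by case: l => [[|[|l]] hl] //; [left|right]; apply/val_inj.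
  by case: (dec i) => ->; case: (dec j) => ->.
- move=> z.
  have [a ha] := eRe z; have [d hd] := fRf z.
  have [b hb] := eRe (z * q); have [g hg] := eRe (p * z).
  pose m : 'M[F]_2 := \matrix_(i, j)
    if i == i0 then if j == i0 then a else b else if j == i0 then g else d.
  exists m; rewrite /T !mxE /= -ha -hd.
  have -> : k b * p = e * z * f.
    by rewrite -[in LHS]ep mulrA -hb -!mulrA ep qp.
  have -> : k g * q = f * z * e.
    by rewrite -[in LHS]qe mulrA kC -mulrA -hg !mulrA qe qp.
  rewrite -[RHS]mulr1 -[z in RHS]mul1r -ef1.
  ncring.
Qed.
Lemma scalar_reg_eq a b x : x <> 0 -> k a * x = k b * x -> a = b.
Proof.
move=> x0 h; have : k (a - b) * x = 0 by rewrite scalarB mulrBl h subrr.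
by case/(scalar_reg) => // /eqP; rewrite subr_eq0 => /eqP.
Qed.

Lemma scalar_of_simple_commutative :
  (forall z, central z -> exists c, z = k c) ->
  (forall x y : R, x * y = y * x) -> scalar_ring.
Proof. by move=> kS h x; apply: kS. Qed.

(** The eigenprojections are (1 + d) / 2 and (1 - d) / 2. *)
Lemma involution_idempotent (d : R) : d * d = 1 -> d <> 1 -> d <> -1 ->
  exists e f : R, [/\ e * e = e, e + f = 1, e <> 0, f <> 0 & d = e - f].
Proof.
move=> dd d1 dN1; pose h := 2^-1 : F.
have h2 : k h + k h = 1.
  by rewrite -scalarD -[h]mulr1 -mulrDr -[1 + 1]/(2%:R) mulVf ?pnatr_eq0 // scalar1.
have h0 x : k h * x = 0 -> x = 0.
  case/scalar_reg => // /eqP; rewrite invr_eq0 pnatr_eq0 //.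
exists (k h * (1 + d)), (k h * (1 - d)); split.
- apply: (use_eq (k h) (1 + d) (esym (kC h (1 + d)))).
  apply: (use_eq (k h * k h) 1 dd).
  apply: (use_eq (k h) (1 + d) h2).
  ncring.
- by apply: (use_eq 1 1 h2); ncring.
- move/h0/eqP; rewrite addr_eq0 => /eqP h1; apply: dN1.
  by rewrite h1 opprK.
- by move/h0/eqP; rewrite subr_eq0 => /eqP h1; apply: d1.
- by apply: (use_eq (-1) d h2); ncring.
Qed.

(** Linearization in r gives u r u s u = - u s u r u, hence (u r u) s (u r u)
    = - u s (u r u r u) = 0, and semiprimeness is used twice. *)
Lemma square_zero_sandwich (u : R) : (forall r, u * r * u * r * u = 0) -> u = 0.
Proof.
move=> h; have lin r s : u * r * u * s * u + u * s * u * r * u = 0.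
  apply: (use_eq 1 1 (h (r + s))).
  apply: (use_eq (-1) 1 (h r)).
  apply: (use_eq (-1) 1 (h s)).
  ncring.
have ss := simple_semiprime sR.
apply: (ss) => r; apply: (ss) => s.
apply: (use_eq 1 (r * u) (lin r s)).
apply: (use_eq (- (u * s)) 1 (h r)).
ncring.
Qed.

Section Quadratic.
Hypothesis quad : forall t : R,
  (exists c, t = k c) \/ exists a b, t * t = k a * t + k b.

(** A nonscalar x in the corner eRe could be modified by a multiple of f with
    an eigenvalue that x does not have, which would produce an element of
    degree three. *)
Lemma quadratic_corner (e f x : R) : e * e = e -> e + f = 1 -> f <> 0 ->
  exists c, e * x * e = k c * e.
Proof.
move=> ee ef1 f0; case: (pselect (e = 0)) => [->|e0].
  by exists 0; rewrite !mulr0.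
have fE : f = 1 - e by rewrite -ef1 addrAC subrr add0r.
have ef : e * f = 0 by rewrite fE mulrBr mulr1 ee subrr.
have fe : f * e = 0 by rewrite fE mulrBl mul1r ee subrr.
have ff : f * f = f by rewrite {1}fE mulrBl mul1r ef subr0.
pose X := e * x * e.
have Xf : X * f = 0 by rewrite /X -mulrA ef mulr0.
have fX : f * X = 0 by rewrite /X !mulrA fe !mul0r.
have Xe : X * e = X by rewrite /X -mulrA ee.
rewrite -/X; clearbody X.
have [[c hc]|[a [b hab]]] := quad X.
  exists 0; have : k c * f = 0 by rewrite -hc.
  rewrite scalar0 mul0r; by case/scalar_reg => // c0; rewrite hc c0 scalar0.
have b0 : b = 0.
  apply: (scalar_reg_eq f0); rewrite scalar0 mul0r.
  have := congr1 (fun z => z * f) hab.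
  by rewrite /= mulrDl -!mulrA Xf !mulr0 add0r.
have XX : X * X = k a * X by rewrite hab b0 scalar0 addr0.
(* any scalar distinct from 0 and a *)
have [al al0 ala] : exists2 al : F, al <> 0 & al <> a.
  case: (eqVneq a 1) => [->|/eqP a1]; last first.
    by exists 1 => [|/esym//]; apply/eqP; rewrite oner_eq0.
  by exists 2 => [|h]; [apply/eqP; rewrite pnatr_eq0 | have := eqr_nat F 2 1; rewrite h eqxx].
pose t := X + k al * f.
have tf : t * f = k al * f by rewrite /t mulrDl Xf add0r -mulrA ff.
have te : t * e = X by rewrite /t mulrDl Xe -mulrA fe mulr0 addr0.
have tX : t * X = X * X by rewrite /t mulrDl -mulrA fX mulr0 addr0.
clearbody t.
have [[c hc]|[p [q hpq]]] := quad t.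
  by exists c; rewrite -te hc.
have h1 : al * al = p * al + q.
  apply: (scalar_reg_eq f0); rewrite scalarD !scalarM.
  apply: (use_eq 1 f hpq).
  apply: (use_eq (k p - t - k al) 1 tf).
  apply: (use_eq 1 f (kC al t)).
  ncring.
have h2 : X * X = k p * X + k q * e.
  have := congr1 (fun z => z * e) hpq.
  by rewrite /= mulrDl -!mulrA te tX.
have h3 : k (a - p) * X = k q * e.
  by rewrite scalarB mulrBl -XX h2 addrAC subrr add0r.
case: (eqVneq a p) => [ap|nap].
  have q0 : q = 0.
    by apply: (scalar_reg_eq e0); rewrite -h3 ap subrr !scalar0 !mul0r.
  by case: ala; apply: (mulIf (introN eqP al0)); rewrite h1 q0 addr0 ap.
exists (q / (a - p)); rewrite mulrC scalarM -mulrA -h3 mulrA scalar_unit ?mul1r //.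
by rewrite subr_eq0.
Qed.

(** After completing the square, a nonscalar element yields u with u^2 a
    scalar. If the scalar is not zero, then u is a multiple of an involution.
    If u^2 = 0, then some product u r is not nilpotent, and it is a multiple
    of an idempotent. *)
Lemma quadratic_idempotent : ~ scalar_ring ->
  exists e f : R, [/\ e * e = e, e + f = 1, e <> 0 & f <> 0].
Proof.
move=> ns.
have [t ht] : exists t, ~ exists c, t = k c.
  by apply: contrapT => hn; apply: ns => t; apply: contrapT => h; apply: hn; exists t.
have [//|[a [b hab]]] := quad t.
pose h := a / 2; have hh : a = h + h by rewrite -[RHS]splitr.
pose u := t - k h.
have uu : u * u = k (b + h * h).
  rewrite scalarD scalarM; apply: (use_eq 1 1 hab).
  rewrite hh scalarD; apply: (use_eq 1 1 (kC h t)); rewrite /u; ncring.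
have uns c : u <> k c.
  by move=> uc; apply: ht; exists (c + h); rewrite scalarD -uc subrK.
case: (eqVneq (b + h * h) 0) => [c0|c0]; last first.
  pose s := sqrtC (b + h * h).
  have s0 : s != 0 by rewrite sqrtC_eq0.
  have us (z : F) : k s^-1 * u = k z -> False.
    move=> hz; apply: (uns (s * z)).
    by rewrite scalarM -hz mulrA -scalarM divff // scalar1 mul1r.
  have [||| e [f [ee ef e0 f0 _]]] := @involution_idempotent (k s^-1 * u).
  - have ss : u * u = k s * k s by rewrite uu -scalarM -[s * s]expr2 sqrtCK.
    have pp : k s^-1 * k s = 1 by rewrite -scalarM mulVf // scalar1.
    apply: (use_eq (- k s^-1) u (kC s^-1 u)).
    apply: (use_eq (k s^-1 * k s^-1) 1 ss).
    apply: (use_eq (k s^-1) (k s) pp).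
    apply: (use_eq 1 1 pp).
    ncring.
  - by rewrite -scalar1; apply: us.
  - by rewrite -scalar1 -scalarN; apply: us.
  by exists e, f.
rewrite c0 scalar0 in uu.
have u0 : u <> 0 by rewrite -scalar0; apply: uns.
have [r hr] : exists r, u * r * u * r <> 0.
  apply: contrapT => hn; apply: u0; apply: square_zero_sandwich => r.
  have -> : u * r * u * r = 0 by apply: contrapT => h'; apply: hn; exists r.
  by rewrite mul0r.
pose v := u * r; have vv : v * v <> 0 by rewrite /v mulrA.
have uv : u * v = 0 by rewrite /v mulrA uu mul0r.
clearbody v.
have [[c hc]|[p [q hpq]]] := quad v.
  have : k c * u = 0 by rewrite kC -hc.
  by case/scalar_reg => // c0'; case: vv; rewrite hc c0' scalar0 mul0r.
have q0 : q = 0.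
  have : k q * u = 0.
    rewrite kC; have := congr1 (fun z => u * z) hpq.
    by rewrite /= mulrDr !mulrA uv -kC -mulrA uv mulr0 mul0r add0r.
  by case/scalar_reg.
rewrite q0 scalar0 addr0 in hpq.
have p0 : p != 0 by apply/eqP => p0; apply: vv; rewrite hpq p0 scalar0 mul0r.
pose e := k p^-1 * v.
have ue : u * e = 0 by rewrite /e mulrA -kC -mulrA uv mulr0.
exists e, (1 - e); split; last first.
- move=> h1; apply: u0; rewrite -[u]mulr1.
  by rewrite -[1](subrK e) h1 add0r.
- move=> e0; apply: vv; rewrite hpq -[v]mul1r -scalar1 -(mulfV p0) scalarM -mulrA.
  by rewrite -/e e0 !mulr0.
- by rewrite addrC subrK.
- have pp : k p^-1 * k p = 1 by rewrite -scalarM mulVf // scalar1.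
  apply: (use_eq (k p^-1 * k p^-1) 1 hpq).
  apply: (use_eq (k p^-1) v pp).
  apply: (use_eq (- k p^-1) v (kC p^-1 v)).
  rewrite /e; ncring.
Qed.

(** Kaplansky's theorem on simple algebras of degree at most two. It
    identifies the quotients on which all defects vanish. *)
Lemma quadratic_simple_ring : scalar_ring \/ matrix2_ring.
Proof.
case: (pselect (scalar_ring)) => [|ns]; [by left|right].
have [e [f [ee ef e0 f0]]] := quadratic_idempotent ns.
apply: (matrix2_of_corners ee ef e0 f0) => x.
  exact: quadratic_corner ee ef f0.
have fE : f = 1 - e by rewrite -ef addrAC subrr add0r.
apply: (@quadratic_corner _ e) => //; last by rewrite addrC.
by rewrite fE; apply: (use_eq 1 1 ee); ncring.
Qed.
End Quadratic.

Section DoubleCommutators.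
Hypothesis kS : forall z : R, central z -> exists c, z = k c.
Hypothesis dd_central : forall x a b y c d : R,
  central (jord (lie x (lie a b)) (lie y (lie c d))).

(** Put g = [a, b]. If [x, g] were nonzero, it would be an invertible central
    element, and since [x g, g] = [x, g] g is central too, g would be central.
    *)
Lemma triple_commutator_central (x a b : R) :
  (forall x a b : R, central (lie x (lie a b))) -> lie x (lie a b) = 0.
Proof.
move=> h; pose g := lie a b; rewrite -/g.
case: (pselect (lie x g = 0)) => // n0.
suff cg : central g by rewrite -(cg x) subrr.
have [w hw] := simple_central_unit sR (h x a b) n0.
rewrite -/g in hw.
have -> : g = lie (x * g) g * w.
  rewrite -[g in LHS]mul1r -hw (_ : lie (x * g) g = lie x g * g); last by ncring.
  have cw : central w := central_inverse (h x a b) hw.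
  by rewrite -!mulrA -(cw g).
by apply: centralM; [exact: h | exact: central_inverse (h x a b) hw].
Qed.

(** The double commutators of a matrix algebra span the traceless matrices,
    and a traceless matrix of size at least three need not have a scalar
    square. For the proof, a double commutator d with nonzero square is
    rescaled to an involution e - f; the components eRf and fRe consist again
    of double commutators, so that the products of eRf with fRe are multiples
    of e, and this forces eRe to consist of scalars. *)
Lemma double_commutator_simple_ring : scalar_ring \/ matrix2_ring.
Proof.
have scal : (forall x a b : R, lie x (lie a b) = 0) -> scalar_ring.
  move=> h; apply: scalar_of_simple_commutative => // x y.
  have ss := simple_semiprime sR.
  have cl (a b : R) : central (lie a b).
    by move=> z; apply/esym/eqP; rewrite -subr_eq0; apply/eqP/h.
  apply/eqP; rewrite -subr_eq0; apply/eqP; apply: ss => b.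
  have h1 : lie x y * lie b y = 0.
    have := h x (b * y) y.
    rewrite (_ : lie (b * y) y = lie b y * y); last by ncring.
    move=> h2; have := h x b y => h3.
    apply: (use_eq 1 1 h2).
    apply: (use_eq (-1) y h3).
    apply: (use_eq (-1) 1 (cl b y (lie x y))).
    ncring.
  have h4 : lie x y * lie (b * x) y = 0.
    have := h x (b * x * y) y.
    rewrite (_ : lie (b * x * y) y = lie (b * x) y * y); last by ncring.
    move=> h2; have := h x (b * x) y => h3.
    apply: (use_eq 1 1 h2).
    apply: (use_eq (-1) y h3).
    apply: (use_eq (-1) 1 (cl (b * x) y (lie x y))).
    ncring.
  apply: (use_eq 1 1 h4).
  apply: (use_eq (-1) x h1).
  ncring.
case: (pselect (exists x a b : R, lie x (lie a b) * lie x (lie a b) <> 0)); last first.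
  move=> hn; left; apply: scal => x a b.
  have sq (y c d : R) : lie y (lie c d) * lie y (lie c d) = 0.
    by apply: contrapT => h; apply: hn; exists y, c, d.
  apply: square_zero_sandwich => r.
  have := sq r x (lie a b); have := sq x a b.
  move: (lie x (lie a b)) => u uu h.
  apply: (use_eq 1 u h).
  apply: (use_eq r (r * u) uu).
  apply: (use_eq (u * r * r - r * u * r) 1 uu).
  ncring.
case=> x [a [b dd0]].
pose d0 := lie x (lie a b); rewrite -/d0 in dd0.
have [c hc] : exists c, d0 * d0 = k c.
  have [c hc] := kS (dd_central x a b x a b).
  exists (c / 2); rewrite -/d0 in hc.
  have h2 : k 2^-1 * (1 + 1) = 1.
    by rewrite -scalar1 -scalarD -scalarM mulVf ?pnatr_eq0.
  rewrite scalarM -hc -kC.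
  apply: (use_eq (-1) (d0 * d0) h2).
  ncring.
have c0 : c != 0 by apply/eqP => c0; apply: dd0; rewrite hc c0 scalar0.
pose s := sqrtC c; have s0 : s != 0 by rewrite sqrtC_eq0.
have pp : k s^-1 * k s = 1 by rewrite -scalarM mulVf // scalar1.
pose d := k s^-1 * d0.
have dl : d = lie (k s^-1 * x) (lie a b).
  rewrite /d /d0; apply: (use_eq (-1) x (kC s^-1 (lie a b))); ncring.
have dd : d * d = 1.
  have ss : d0 * d0 = k s * k s by rewrite hc -scalarM -[s * s]expr2 sqrtCK.
  apply: (use_eq (- k s^-1) d0 (kC s^-1 d0)).
  apply: (use_eq (k s^-1 * k s^-1) 1 ss).
  apply: (use_eq (k s^-1) (k s) pp).
  apply: (use_eq 1 1 pp).
  rewrite /d; ncring.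
have h2 : k 2^-1 + k 2^-1 = 1.
  by rewrite -scalarD -[2^-1]mulr1 -mulrDr -[1 + 1]/(2%:R) mulVf ?pnatr_eq0 // scalar1.
have dnc : ~ central d.
  move=> cd; apply: dd0; rewrite /d0 triple_commutator_central ?mul0r //.
  move=> y a' b'.
  have -> : lie y (lie a' b') = k 2^-1 * (d * jord d (lie y (lie a' b'))).
    have := cd (lie y (lie a' b')); move: (lie y _) => g cg.
    apply: (use_eq (k 2^-1 * d) 1 cg).
    apply: (use_eq (- (k 2^-1 + k 2^-1)) g dd).
    apply: (use_eq (-1) g h2).
    ncring.
  apply: centralM; first exact: kC.
  by apply: centralM => //; rewrite dl; apply: dd_central.
have [||e [f [ee ef1 e0 f0 def]]] := involution_idempotent dd.
- by move=> d1; apply: dnc; rewrite d1; apply: central1.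
- by move=> d1; apply: dnc; rewrite d1; apply/centralN/central1.
right.
have h4 : k 4^-1 *+ 4 = 1.
  by rewrite -[LHS](rmorphMn k) -[_ *+ 4]mulr_natr mulVf ?pnatr_eq0 // -scalar1.
(* off-diagonal Peirce components are double commutators with d *)
have off (u v z : R) : u * u = u -> v * v = v -> u * v = 0 -> v * u = 0 ->
    d = u - v \/ d = v - u ->
    exists y a b, u * z * v = lie y (lie a b).
  move=> uu vv uv vu du; exists (k 4^-1 * d), d, (u * z * v).
  have [[dm md]|[dm md]] : (d * (u * z * v) = u * z * v /\
        u * z * v * d = - (u * z * v)) \/
      (d * (u * z * v) = - (u * z * v) /\ u * z * v * d = u * z * v).
    case: du => ->; [left | right]; split.
    - apply: (use_eq 1 (z * v) uu).
      by apply: (use_eq (-1) (z * v) vu); ncring.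
    - apply: (use_eq (u * z) 1 vu).
      by apply: (use_eq (- (u * z)) 1 vv); ncring.
    - apply: (use_eq (-1) (z * v) uu).
      by apply: (use_eq 1 (z * v) vu); ncring.
    - apply: (use_eq (- (u * z)) 1 vu).
      by apply: (use_eq (u * z) 1 vv); ncring.
  - move: (u * z * v) dm md => m dm md; rewrite dm md.
    apply: (use_eq (- k 4^-1 *+ 2) 1 dm).
    apply: (use_eq (k 4^-1 *+ 2) 1 md).
    apply: (use_eq (-1 *+ 2) d (kC 4^-1 m)).
    apply: (use_eq (-1) m h4).
    ncring.
  - move: (u * z * v) dm md => m dm md; rewrite dm md.
    apply: (use_eq (k 4^-1 *+ 2) 1 dm).
    apply: (use_eq (- k 4^-1 *+ 2) 1 md).
    apply: (use_eq (1 *+ 2) d (kC 4^-1 m)).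
    apply: (use_eq (-1) m h4).
    ncring.
have corner (u v : R) : u * u = u -> v * v = v -> u * v = 0 -> v * u = 0 ->
    u + v = 1 -> u <> 0 -> v <> 0 ->
    d = u - v \/ d = v - u -> forall z, exists c, u * z * u = k c * u.
  move=> uu vv uv vu uv1 u0 v0 du z.
  have mix (z1 z2 : R) : exists c, (u * z1 * v) * (v * z2 * u) = k c * u.
    have [y1 [a1 [b1 e1]]] := off u v z1 uu vv uv vu du.
    have [y2 [a2 [b2 e2]]] := off v u z2 vv uu vu uv (proj1 (or_comm _ _) du).
    have := dd_central y1 a1 b1 y2 a2 b2; rewrite -e1 -e2 => /kS[c1 hc1].
    exists c1; apply: (use_eq 1 u hc1).
    apply: (use_eq (- (u * z1 * v * v * z2)) 1 uu).
    apply: (use_eq (- (v * z2 * u * u * z1)) 1 vu).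
    ncring.
  have [x1 hx] : exists x1, u * x1 * v <> 0.
    apply: contrapT => hn; apply: v0; apply: (simple_prime sR _ u0) => g.
    by apply: contrapT => hb; apply: hn; exists g.
  have [y1 hy] : exists y1, (u * x1 * v) * y1 * u <> 0.
    apply: contrapT => hn; apply: u0; apply: (simple_prime sR _ hx) => g.
    by apply: contrapT => hb; apply: hn; exists g.
  have [c1 hc1] := mix x1 y1.
  have [c2 hc2] := mix (z * u * x1) y1.
  have c10 : c1 != 0.
    apply/eqP => c10; apply: hy.
    have : (u * x1 * v) * (v * y1 * u) = 0 by rewrite hc1 c10 scalar0 mul0r.
    by rewrite -!mulrA [v * (v * _)]mulrA vv.
  exists (c1^-1 * c2); rewrite scalarM -[k _ * k _ * u]mulrA -hc2.
  have p1 : k c1^-1 * k c1 = 1 by rewrite -scalarM mulVf // scalar1.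
  apply: (use_eq (-1) (u * z * u) p1).
  apply: (use_eq (k c1^-1) u (kC c1 (u * z))).
  apply: (use_eq (- (k c1^-1 * u * z)) 1 hc1).
  ncring.
have fE : f = 1 - e by rewrite -ef1 addrAC subrr add0r.
have ef : e * f = 0 by rewrite fE mulrBr mulr1 ee subrr.
have fe : f * e = 0 by rewrite fE mulrBl mul1r ee subrr.
have ff : f * f = f by rewrite {1}fE mulrBl mul1r ef subr0.
apply: (matrix2_of_corners ee ef1 e0 f0).
  by apply: (corner e f) => //; left.
by apply: (corner f e) => //; [rewrite addrC | right].
Qed.
End DoubleCommutators.

End SimpleAlgebra.

(** * Functional identities *)

Section FunctionalIdentities.
Variables (B : pzRingType) (X : Type) (h : X -> B) (s : B -> X).
Hypothesis hs : cancel s h.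
Hypothesis HB : generates_unit (@is_quad_defect B).

Definition sandwich (l : seq (B * B)) (z : B) : B := \sum_(p <- l) p.1 * z * p.2.

(** A defect is the value at t^2 of a two-sided multiplication annihilating 1
    and t, and such multiplications extract the leading coefficient of an
    expression of degree two in t. *)
Lemma defect_ind (I : B -> Prop) : two_sided I ->
  (forall t l, sandwich l 1 = 0 -> sandwich l t = 0 -> I (sandwich l (t * t))) ->
  I 1.
Proof.
move=> tI hI; apply: HB => // _ [t [w [u [v ->]]]].
pose l : seq (B * B) := [:: (1, w * u * lie t v); (- w, u * lie t v);
  (- (lie t w * u), v); (lie t w * u * v, 1)].
have lE z : sandwich l z = lie z w * u * lie t v - lie t w * u * lie z v.
  by rewrite /sandwich !big_cons big_nil /=; ncring.
have := hI t l; rewrite !lE; apply; ncring.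
Qed.

Lemma right_sandwich t l (A2 A1 A0 : B) (r : X -> B) :
  sandwich l 1 = 0 -> sandwich l t = 0 ->
  (forall x, A2 * h x * t * t + A1 * h x * t + A0 * h x = r x) ->
  forall x, A2 * h x * sandwich l (t * t) =
    \sum_(p <- l) r (s (h x * p.1)) * p.2.
Proof.
move=> l1 lt e x.
have -> : A2 * h x * sandwich l (t * t) = A2 * h x * sandwich l (t * t) +
    A1 * h x * sandwich l t + A0 * h x * sandwich l 1.
  by rewrite l1 lt !mulr0 !addr0.
rewrite /sandwich !mulr_sumr -!big_split /=; apply: eq_bigr => p _.
by rewrite -e hs; ncring.
Qed.

Lemma left_sandwich t l (A2 A1 A0 : B) (r : X -> B) :
  sandwich l 1 = 0 -> sandwich l t = 0 ->
  (forall x, t * t * h x * A2 + t * h x * A1 + h x * A0 = r x) ->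
  forall x, sandwich l (t * t) * h x * A2 =
    \sum_(p <- l) p.1 * r (s (p.2 * h x)).
Proof.
move=> l1 lt e x.
have -> : sandwich l (t * t) * h x * A2 = sandwich l (t * t) * h x * A2 +
    sandwich l t * h x * A1 + sandwich l 1 * h x * A0.
  by rewrite l1 lt !mul0r !addr0.
rewrite /sandwich !mulr_suml -!big_split /=; apply: eq_bigr => p _.
by rewrite -e hs; ncring.
Qed.

(** Replace y by a preimage of h y * t and subtract the identity multiplied by
    t: the term T z x h y disappears. Doing this for y and for z leaves an
    expression of degree two in t on the right of h x, with leading
    coefficient T y z, which a sandwich extracts. The set of all c that
    satisfy the conclusion multiplied by c is an ideal, so the results for
    different t combine. *)
Lemma fi_two_sided3 (T : X -> X -> B) :
  (forall x y z, lie (T x y) (h z) + lie (T y z) (h x) + lie (T z x) (h y) = 0) ->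
  exists K L M : X -> X -> B, forall x y z,
    T y z * h x = h x * K y z + h z * L x y + h y * M x z.
Proof.
move=> e.
suff [K [L [M KLM]]] : exists K L M : X -> X -> B, forall x y z,
    T y z * h x * 1 = h x * K y z + h z * L x y + h y * M x z.
  by exists K, L, M => x y z; rewrite -KLM mulr1.
apply: (@defect_ind (fun c => exists K L M : X -> X -> B, forall x y z,
    T y z * h x * c = h x * K y z + h z * L x y + h y * M x z)).
  split.
  - by exists (fun _ _ => 0), (fun _ _ => 0), (fun _ _ => 0) => x y z; ncring.
  - move=> c d [K [L [M hc]]] [K' [L' [M' hd]]].
    exists (fun y z => K y z + K' y z), (fun y z => L y z + L' y z),
      (fun y z => M y z + M' y z) => x y z.
    by rewrite mulrDr hc hd; ncring.
  - move=> a c b [K [L [M hc]]].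
    exists (fun y z => a * K y z * b), (fun x y => L (s (h x * a)) y * b),
      (fun x z => M (s (h x * a)) z * b) => x y z.
    have := hc (s (h x * a)) y z; rewrite hs => hc'.
    apply: (use_eq 1 b hc'); ncring.
move=> t l l1 lt.
pose m x := s (h x * t); have hm x : h (m x) = h x * t by rewrite /m hs.
pose G y z := T (m y) (m z) - T (m y) z * t - T y (m z) * t + T y z * t * t.
pose L x y := t * T x (m y) - T x (m y) * t - t * T x y * t + T x y * t * t.
pose M x z := t * T (m z) x - t * T z x * t - T (m z) x * t + T z x * t * t.
have e2 y z x : T y z * h x * t * t + (- (T (m y) z + T y (m z))) * h x * t
    + T (m y) (m z) * h x = h x * G y z + h z * L x y + h y * M x z.
  have e1 := e x (m y) (m z); have e3 := e x (m y) z.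
  have e4 := e x y (m z); rewrite !hm in e1 e3 e4.
  apply: (use_eq 1 1 e1).
  apply: (use_eq (-1) t e3).
  apply: (use_eq (-1) t e4).
  apply: (use_eq 1 (t * t) (e x y z)).
  rewrite /G /L /M; ncring.
exists (fun y z => \sum_(p <- l) p.1 * G y z * p.2),
  (fun x y => \sum_(p <- l) L (s (h x * p.1)) y * p.2),
  (fun x z => \sum_(p <- l) M (s (h x * p.1)) z * p.2) => x y z.
rewrite (right_sandwich l1 lt (e2 y z)) !mulr_sumr -!big_split /=.
by apply: eq_bigr => p _; rewrite hs; ncring.
Qed.

(** The eliminations are made on the left, with t * h y and t * h z in place
    of h y and h z. They leave a relation t^2 x K + t x K' + x K'' = W x with
    K = K y z, and a sandwich turns it into c x K = W' x, where x = 1 shows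
    that W' = c K. *)
Lemma fi_central3 (K U V : X -> X -> B) :
  (forall x y z, lie (K y z) (h x) = h z * U x y + h y * V x z) ->
  forall y z, central (K y z).
Proof.
move=> e y z.
suff h1 : forall w x, 1 * w * lie (K y z) x = 0.
  move=> x; have := h1 1 x; rewrite !mul1r => /eqP.
  by rewrite subr_eq0 => /eqP.
apply: (@defect_ind (fun c => forall w x, c * w * lie (K y z) x = 0)).
  split.
  - by move=> w x; rewrite !mul0r.
  - by move=> c d hc hd w x; rewrite !mulrDl hc hd addr0.
  - move=> a c b hc w x.
    by apply: (use_eq a 1 (hc (b * w) x)); ncring.
move=> t l l1 lt.
pose m x := s (t * h x); have hm x : h (m x) = t * h x by rewrite /m hs.
pose W := K (m y) (m z) - t * K y (m z) - t * K (m y) z + t * t * K y z.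
have e2 x : t * t * h x * K y z + t * h x * (- (K (m y) z + K y (m z)))
    + h x * K (m y) (m z) = W * h x.
  have e1 := e x (m y) (m z); have e3 := e x (m y) z.
  have e4 := e x y (m z); rewrite !hm in e1 e3 e4.
  apply: (use_eq (-1) 1 e1).
  apply: (use_eq t 1 e3).
  apply: (use_eq t 1 e4).
  apply: (use_eq (- (t * t)) 1 (e x y z)).
  rewrite /W; ncring.
have e3 x : sandwich l (t * t) * x * K y z = (\sum_(p <- l) p.1 * (W * p.2)) * x.
  have := left_sandwich l1 lt e2 (s x); rewrite hs => ->.
  by rewrite mulr_suml; apply: eq_bigr => p _; rewrite hs !mulrA.
have e4 x : sandwich l (t * t) * lie (K y z) x = 0.
  have h1 := e3 x; have h2 := e3 1.
  apply: (use_eq (-1) 1 h1).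
  apply: (use_eq 1 x h2).
  ncring.
move=> w x.
apply: (use_eq 1 1 (e4 (w * x))).
apply: (use_eq (-1) x (e4 w)).
ncring.
Qed.

(** The terms that begin with h y and h z are eliminated by replacing h y with
    t * h y and h z with t * h z. *)
Lemma fi_one_sided3 (P Q R : X -> X -> B) :
  (forall x y z, h x * P y z + h y * Q z x + h z * R x y = 0) ->
  forall y z, P y z = 0.
Proof.
move=> e y z.
suff h1 : forall w, 1 * w * P y z = 0 by have := h1 1; rewrite !mul1r.
apply: (@defect_ind (fun c => forall w, c * w * P y z = 0)).
  split.
  - by move=> w; rewrite !mul0r.
  - by move=> c d hc hd w; rewrite !mulrDl hc hd addr0.
  - move=> a c b hc w.
    by apply: (use_eq a 1 (hc (b * w))); ncring.
move=> t l l1 lt.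
pose m x := s (t * h x); have hm x : h (m x) = t * h x by rewrite /m hs.
have e2 x : t * t * h x * P y z + t * h x * (- (P (m y) z + P y (m z)))
    + h x * P (m y) (m z) = 0.
  have e1 := e x (m y) (m z); have e3 := e x (m y) z.
  have e4 := e x y (m z); rewrite !hm in e1 e3 e4.
  apply: (use_eq 1 1 e1).
  apply: (use_eq (- t) 1 e3).
  apply: (use_eq (- t) 1 e4).
  apply: (use_eq (t * t) 1 (e x y z)).
  ncring.
move=> w; have := left_sandwich l1 lt e2 (s w); rewrite hs => ->.
by rewrite big1 // => p _; rewrite mulr0.
Qed.

(** The elimination of one variable leaves degree one in t, so the identity is
    multiplied by t before a sandwich is applied. The central part mu is then
    obtained as in the case of three variables. *)
Lemma fi_two_sided2 (L M L' M' : X -> B) :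
  (forall y z, M y * h z + L z * h y = h z * L' y + h y * M' z) ->
  exists (a : B) (mu : X -> B), (forall y, central (mu y)) /\
    forall y, M y = h y * a + mu y.
Proof.
move=> e.
have [P [Q PQ]] : exists P Q : X -> B, forall y z, M y * h z * 1 = h z * P y + h y * Q z.
  apply: (@defect_ind (fun c => exists P Q : X -> B, forall y z,
     M y * h z * c = h z * P y + h y * Q z)).
    split.
    - by exists (fun _ => 0), (fun _ => 0) => y z; ncring.
    - move=> c d [P [Q hc]] [P' [Q' hd]].
      exists (fun y => P y + P' y), (fun z => Q z + Q' z) => y z.
      by rewrite mulrDr hc hd; ncring.
    - move=> a c b [P [Q hc]].
      exists (fun y => a * P y * b), (fun z => Q (s (h z * a)) * b) => y z.
      have := hc y (s (h z * a)); rewrite hs => hc'.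
      apply: (use_eq 1 b hc'); ncring.
  move=> t l l1 lt.
  pose m x := s (h x * t); have hm x : h (m x) = h x * t by rewrite /m hs.
  have e2 y z : M y * h z * t * t + (- M (m y)) * h z * t + 0 * h z =
      h z * (L' y * t - L' (m y)) * t + h y * (M' z * t - t * M' z) * t.
    have e1 := e (m y) z; rewrite hm in e1.
    apply: (use_eq (-1) t e1).
    apply: (use_eq 1 (t * t) (e y z)).
    ncring.
  exists (fun y => \sum_(p <- l) p.1 * (L' y * t - L' (m y)) * t * p.2),
    (fun z => \sum_(p <- l) (M' (s (h z * p.1)) * t - t * M' (s (h z * p.1))) * t * p.2)
    => y z.
  rewrite (right_sandwich l1 lt (e2 y)) !mulr_sumr -!big_split /=.
  by apply: eq_bigr => p _; rewrite hs; ncring.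
have hP y : M y = P y + h y * Q (s 1).
  by have := PQ y (s 1); rewrite hs !mulr1 mul1r.
exists (Q (s 1)), P; split; last by move=> y; rewrite addrC.
have e1 y z : lie (P y) (h z) = h y * (Q z - Q (s 1) * h z).
  by have := PQ y z; rewrite hP => e1; apply: (use_eq 1 1 e1); ncring.
move=> y x.
pose V (_ z : X) := Q z - Q (s 1) * h z.
have := @fi_central3 (fun y _ => P y) (fun _ _ => 0) (fun x _ => V x x).
move=> /(_ _ y y x); apply.
by move=> {}x {}y z; rewrite mulr0 add0r /V e1.
Qed.

End FunctionalIdentities.

(** * Commuting traces of biadditive maps *)

Section Half.
Variables (B : pzRingType) (hf : B).
Hypothesis hf2 : hf + hf = 1.

Lemma double_eq0 (x : B) : x + x = 0 -> x = 0.
Proof.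
move=> xx; apply: (use_eq (-1) x hf2).
by apply: (use_eq hf 1 xx); ncring.
Qed.

Lemma half_central : central hf.
Proof.
move=> x; apply/eqP; rewrite -subr_eq0; apply/eqP/double_eq0.
apply: (use_eq 1 x hf2).
by apply: (use_eq (- x) 1 hf2); ncring.
Qed.
End Half.

Section DefectRing.
Variable B : pzRingType.
Hypothesis HB : generates_unit (@is_quad_defect B).

(** The annihilator of a central element is an ideal, and the defects are sums
    of multiples of commutators. *)
Lemma kills_commutators (d : B) : central d ->
  (forall x y : B, d * lie x y = 0) -> d = 0.
Proof.
move=> cd hd; rewrite -[d]mulr1.
apply: (HB (I := fun c => d * c = 0)) => [|_ [t [w [u [v ->]]]]].
  split=> [|x y hx hy|a x b hx]; first by rewrite mulr0.
    by rewrite mulrDr hx hy addr0.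
  by rewrite !mulrA cd -[a * d * x]mulrA hx mulr0 mul0r.
apply: (use_eq 1 (u * lie t v) (hd (t * t) w)).
apply: (use_eq (-1) (u * lie (t * t) v) (hd t w)).
rewrite /quad_defect; ncring.
Qed.

Lemma commutators_generate :
  generates_unit (fun c : B => exists x y, c = lie x y).
Proof.
move=> I tI hI; apply: HB => // _ [t [w [u [v ->]]]].
have hl x y : I (lie x y) by apply: hI; exists x, y.
by apply: two_sided_sub => //; rewrite -mulrA; apply: two_sided_mulr.
Qed.
End DefectRing.

Section CommutingForm.
Variables (A : zmodType) (B : pzRingType) (hf : B) (h : {additive A -> B}).
Variable T : A -> A -> B.
Hypothesis hf2 : hf + hf = 1.
Hypothesis h_surj : forall b, exists a, h a = b.
Hypothesis HB : generates_unit (@is_quad_defect B).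
Hypothesis sB : semiprime B.
Hypothesis TC : forall x y, T x y = T y x.
Hypothesis TD : forall x y z, T (x + y) z = T x z + T y z.
Hypothesis Tcomm : forall x y z,
  lie (T x y) (h z) + lie (T y z) (h x) + lie (T z x) (h y) = 0.

(** The case w = 1 shows that the two inner derivations are opposite, hence
    that [a, z] is central. As [a, a z] = a [a, z] is central too, [a, z]^2 =
    0. *)
Lemma inner_pair_central (a b : B) :
  (forall w z, w * lie a z + lie b z * w = 0) -> central a.
Proof.
move=> e.
have ba z : lie b z = - lie a z.
  by have := e 1 z; rewrite mul1r mulr1 addrC => /eqP; rewrite addr_eq0 => /eqP.
have c z : central (lie a z).
  move=> w; apply/esym; apply: (use_eq 1 1 (e w z)).
  by rewrite ba; ncring.
move=> z; apply/eqP; rewrite -subr_eq0; apply/eqP; apply: sB => x.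
have dd : lie a z * lie a z = 0.
  have h1 := c (a * z) z; have h2 := c z z.
  apply: (use_eq 1 1 h1).
  apply: (use_eq (- a) 1 h2).
  ncring.
by rewrite -mulrA -(c z x) mulrA dd mul0r.
Qed.

(** First T y z = K y z + h z L y + h y M z with K central. Substituted into
    the identity, this gives a one-sided identity that relates L and M, and
    they turn out to be affine functions of h with the same central part mu.
    Symmetrizing T merges the two leading coefficients. *)
Theorem commuting_form : exists (l : B) (mu : {additive A -> B}),
  [/\ central l, (forall x, central (mu x))
   & forall x y, central (T x y - (l * jord (h x) (h y) + mu x * h y + mu y * h x))].
Proof.
have [s hs] := choice h_surj.
have [K [L [M KLM]]] := fi_two_sided3 hs HB Tcomm.
pose L0 := L (s 1); pose M0 := M (s 1).
have e0 y z : T y z = K y z + h z * L0 y + h y * M0 z.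
  by have := KLM (s 1) y z; rewrite hs mulr1 mul1r.
have cK : forall y z, central (K y z).
  apply: (@fi_central3 _ _ _ _ hs HB K (fun x y => L x y - L0 y * h x)
     (fun x z => M x z - M0 z * h x)) => x y z.
  have := KLM x y z; rewrite e0 => e.
  by apply: (use_eq 1 1 e); ncring.
pose P y z := M0 y * h z + L0 z * h y - h z * L0 y - h y * M0 z.
have P0 : forall y z, P y z = 0.
  apply: (@fi_one_sided3 _ _ _ _ hs HB P P P) => x y z.
  have := Tcomm x y z; rewrite !e0 => e.
  apply: (use_eq 1 1 e).
  apply: (use_eq (-1) 1 (cK x y (h z))).
  apply: (use_eq (-1) 1 (cK y z (h x))).
  apply: (use_eq (-1) 1 (cK z x (h y))).
  rewrite /P; ncring.
have [a [mu [cmu M0E]]] : exists (a : B) (mu : A -> B),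
    (forall y, central (mu y)) /\ forall y, M0 y = h y * a + mu y.
  apply: (@fi_two_sided2 _ _ _ _ hs HB L0 M0 L0 M0) => y z.
  by apply: (use_eq 1 1 (P0 y z)); rewrite /P; ncring.
pose b := L0 (s 1) - mu (s 1).
have L0E y : L0 y = b * h y + mu y.
  have := P0 y (s 1); rewrite /P !hs !M0E !hs => e.
  apply: (use_eq (-1) 1 e).
  apply: (use_eq 1 1 (cmu (s 1) (h y))).
  rewrite /b; ncring.
have ab w z : w * lie a z + lie b z * w = 0.
  have := P0 (s w) (s z); rewrite /P !L0E !M0E !hs => e.
  apply: (use_eq 1 1 e).
  apply: (use_eq (-1) 1 (cmu (s w) z)).
  apply: (use_eq (-1) 1 (cmu (s z) w)).
  ncring.
have ca : central a := inner_pair_central ab.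
have cb : central b.
  move=> z; have := ab 1 z; rewrite (ca z) subrr mulr0 add0r mulr1 => /eqP.
  by rewrite subr_eq0 => /eqP.
have TE y z : T y z = K y z + a * (h y * h z) + b * (h z * h y) + mu y * h z + mu z * h y.
  rewrite e0 L0E M0E.
  apply: (use_eq (-1) 1 (ca (h y * h z))).
  apply: (use_eq (-1) (h y) (cb (h z))).
  apply: (use_eq (-1) 1 (cmu y (h z))).
  apply: (use_eq (-1) 1 (cmu z (h y))).
  ncring.
have muD : additive mu.
  have muA x y : mu (x + y) = mu x + mu y.
    apply/eqP; rewrite -subr_eq0; apply/eqP.
    apply: (kills_commutators HB).
      by apply: centralB => //; apply: centralD.
    move=> u v.
    have := TD x y (s u); rewrite !TE !hs !raddfD /= => e.
    have cd : central (mu (x + y) - (mu x + mu y)).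
      by apply: centralB => //; apply: centralD.
    have cKK : central (K x (s u) + K y (s u) - K (x + y) (s u)).
      by apply: centralB => //; apply: centralD.
    have hd : (mu (x + y) - (mu x + mu y)) * u =
        K x (s u) + K y (s u) - K (x + y) (s u).
      by apply: (use_eq 1 1 e); ncring.
    have := cKK v; rewrite -hd => e1.
    apply: (use_eq 1 1 e1).
    apply: (use_eq (-1) u (cd v)).
    ncring.
  have mu0 : mu 0 = 0 by apply: (addrI (mu 0)); rewrite -muA !addr0.
  move=> x y; rewrite muA; congr (_ + _).
  by apply: (addrI (mu y)); rewrite -muA !subrr mu0.
pose muP := GRing.isZmodMorphism.Build A B mu muD.
pose muM : {additive A -> B} := HB.pack mu muP.
have chf := half_central hf2.
exists (hf * (a + b)), muM; split=> //.
  by apply: centralM => //; apply: centralD.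
move=> x y.
have -> : T x y = hf * (T x y + T y x).
  by rewrite (TC y x); apply: (use_eq (-1) (T x y) hf2); ncring.
rewrite !TE /=.
have -> : hf * (K x y + a * (h x * h y) + b * (h y * h x) + mu x * h y + mu y * h x +
   (K y x + a * (h y * h x) + b * (h x * h y) + mu y * h x + mu x * h y)) -
   (hf * (a + b) * jord (h x) (h y) + mu x * h y + mu y * h x) =
   hf * (K x y + K y x).
  apply: (use_eq 1 (mu x * h y + mu y * h x) hf2).
  ncring.
by apply: centralM => //; apply: centralD.
Qed.

End CommutingForm.

(** * Jordan ideals and degenerate forms *)

Section JordanIdeal.
Variables (A : pzRingType) (hf : A).
Hypothesis hf2 : hf + hf = 1.

Definition jordan_ideal (W : A -> Prop) : Prop :=
  [/\ W 0, forall x y, W x -> W y -> W (x + y)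
    & forall x y, W x -> W (jord x y)].

Section Fix.
Variable W : A -> Prop.
Hypothesis jW : jordan_ideal W.

Lemma jordan_idealN x : W x -> W (- x).
Proof.
case: jW => _ _ hJ /(hJ x (- hf)).
rewrite (_ : jord x (- hf) = - x) //.
have c := half_central hf2 x.
apply: (use_eq (- x) 1 hf2).
apply: (use_eq (-1) 1 c).
ncring.
Qed.

Lemma jordan_ideal_half x : W (x + x) -> W x.
Proof.
case: jW => _ _ hJ /(hJ _ (hf * hf)).
rewrite (_ : jord (x + x) (hf * hf) = x) //.
have c := half_central hf2 x.
apply: (use_eq (- (1 + hf *+ 2)) x (esym hf2)).
apply: (use_eq (-1 *+ 2) hf c).
apply: (use_eq (-hf *+ 2) 1 c).
ncring.
Qed.

(** The largest two-sided ideal contained in [W]. *)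
Definition ideal_core (x : A) : Prop := forall a b, W (a * x * b).

Lemma ideal_core_two_sided : two_sided ideal_core.
Proof.
case: (jW) => h0 hD _; split=> [a b|x y hx hy a b|c x d hx a b].
- by rewrite mulr0 mul0r.
- by rewrite mulrDr mulrDl; apply: hD.
- by have := hx (a * c) (d * b); rewrite !mulrA.
Qed.

(** Herstein's argument: [a o b, x] = a o [b, x] + b o [a, x] lies in W
    together with (a o b) o x, hence so does (a o b) x, and multiplication by
    y on the left is treated in the same way. *)
Lemma jord_ideal_core a b : W a -> W b -> ideal_core (jord a b).
Proof.
case: (jW) => h0 hD hJ wa wb.
have h1 x : W (jord a b * x).
  apply: jordan_ideal_half.
  rewrite (_ : jord a b * x + jord a b * x
      = jord (jord a b) x + (jord a (lie b x) + jord b (lie a x))).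
    exact: (hD _ _ (hJ _ x (hJ a b wa)) (hD _ _ (hJ a _ wa) (hJ b _ wb))).
  ncring.
move=> y x.
rewrite (_ : y * _ * x = jord (jord a b * x) y - jord a b * (x * y)); last by ncring.
exact: (hD _ _ (hJ _ y (h1 x)) (jordan_idealN (h1 (x * y)))).
Qed.

(** In a simple quotient that annihilates the core, the image of w satisfies
    w^2 = 0 and w o (w o x) = 0, hence w x w = 0 for all x. *)
Lemma jordan_ideal_kernel (Q : pzRingType) (p : {rmorphism A -> Q}) :
  simple_ring Q -> (forall q, exists a, p a = q) ->
  (forall x, ideal_core x -> p x = 0) -> forall w, W w -> p w = 0.
Proof.
case: (jW) => h0 hD hJ sQ p_surj hp w ww.
apply: (simple_semiprime sQ) => q; have [x <-] := p_surj q.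
have h1 : p (jord w w) = 0 by apply/hp/jord_ideal_core.
have h2 : p (jord w (jord w x)) = 0 by apply/hp/jord_ideal_core => //; apply: hJ.
have hh : p hf + p hf = 1 by rewrite -rmorphD hf2 rmorph1.
move: h1 h2; rewrite !(rmorphD, rmorphM) => h1 h2.
have h1' := double_eq0 hh h1.
apply: (double_eq0 hh).
apply: (use_eq 1 1 h2).
apply: (use_eq (-1) (p x) h1').
apply: (use_eq (- p x) 1 h1').
ncring.
Qed.
End Fix.
End JordanIdeal.

(** If s commutes with all commutators, then 0 = [s, [x, x y]] = [s, x] [x,
    y]. Replacing y by y w gives [s, x] y [x, w] = 0, and the ring is prime.
    *)
Lemma central_of_lie_lie (Q : pzRingType) (s : Q) : simple_ring Q ->
  (forall u v : Q, lie s (lie u v) = 0) -> central s.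
Proof.
move=> sQ e x; apply/eqP; rewrite -subr_eq0; apply/eqP; apply: contrapT => n0.
have h1 y : lie s x * lie x y = 0.
  apply: (use_eq 1 1 (e x (x * y))).
  by apply: (use_eq (- x) 1 (e x y)); ncring.
have cx w : lie x w = 0.
  apply: (simple_prime sQ _ n0) => y.
  apply: (use_eq 1 1 (h1 (y * w))).
  by apply: (use_eq (-1) w (h1 y)); ncring.
by apply: n0; apply: (use_eq (-1) 1 (cx s)); ncring.
Qed.

Section DegenerateForm.
Variables (A C : pzRingType) (phi mu : {additive A -> C}) (hf : C).
Hypothesis hf2 : hf + hf = 1.
Hypothesis sC : simple_ring C.
Hypothesis ncC : ~ forall x y : C, x * y = y * x.
Hypothesis phi_surj : forall c, exists a, phi a = c.
Hypothesis cmu : forall x, central (mu x).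
Hypothesis form : forall x y,
  central (phi (jord x y) - (mu x * phi y + mu y * phi x)).

(** If the Jordan algebra of A is that of a quadratic form, with phi the
    identity, then mu is the trace, and this is the bilinear form of the
    discriminant of the characteristic polynomial. *)
Definition om (x y : A) : C := mu (jord x y) - mu x * mu y.

Lemma om_central x y : central (om x y).
Proof. by apply: centralB => //; apply: centralM. Qed.

Lemma omC x y : om x y = om y x.
Proof. by rewrite /om addrC (cmu x) [in RHS]addrC; congr (_ + _); rewrite addrC. Qed.

Lemma omDl x y z : om (x + y) z = om x z + om y z.
Proof.
rewrite /om (_ : jord (x + y) z = jord x z + jord y z); last by ncring.
by rewrite !raddfD /=; ncring.
Qed.

Lemma omNl x z : om (- x) z = - om x z.
Proof.
rewrite /om (_ : jord (- x) z = - jord x z); last by ncring.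
by rewrite !raddfN /=; ncring.
Qed.

Lemma om_def x y : mu (jord x y) = om x y + mu x * mu y.
Proof. by rewrite /om subrK. Qed.

Lemma central_factor d y : central d -> central (d * phi y) ->
  ~ central (phi y) -> d = 0.
Proof.
move=> cd cdy nc; apply: contrapT => d0; apply: nc.
have [w dw] := simple_central_unit sC cd d0.
have cw := central_inverse cd dw.
by rewrite -[phi y]mul1r -dw (cd w) -mulrA; apply: centralM.
Qed.

Lemma exists_noncentral : exists x, ~ central (phi x).
Proof.
apply: contrapT => hn; apply: ncC => x y; have [a <-] := phi_surj x.
have : central (phi a) by apply: contrapT => h; apply: hn; exists a.
exact.
Qed.

(** Otherwise 2 phi y is congruent to mu y phi 1 modulo the center for all y,
    and C is commutative. *)
Lemma mu1_neq0 : mu 1 <> 0.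
Proof.
move=> m1; apply: ncC => x y; have [a <-] := phi_surj x; have [b <-] := phi_surj y.
have f1 z : central (phi z + phi z - mu z * phi 1).
  by have := form 1 z; rewrite !mul1r !mulr1 m1 mul0r add0r raddfD.
apply/eqP; rewrite -subr_eq0; apply/eqP; do 2!apply: (double_eq0 hf2).
apply: (use_eq 1 1 (f1 a (phi b + phi b))).
apply: (use_eq (-1) 1 (f1 b (mu a * phi 1))).
apply: (use_eq (mu b) (phi 1) (cmu a (phi 1))).
apply: (use_eq (mu a) (phi 1) (esym (cmu b (phi 1)))).
apply: (use_eq 1 (phi 1 * phi 1) (cmu a (mu b))).
ncring.
Qed.

(** The commutator [y, [x, z]] is the associator (x o y) o z - x o (y o z) of
    the Jordan product, and each term is computed by two applications of the
    form. *)
Lemma phi_lie_lie y x z :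
  central (phi (lie y (lie x z)) - (om x y * phi z - om y z * phi x)).
Proof.
rewrite (_ : lie y (lie x z) = jord (jord x y) z - jord x (jord y z)); last by ncring.
have h1 := form (jord x y) z; have h2 := form x (jord y z).
have h3 := form x y; have h4 := form y z.
move: h1 h2 h3 h4; rewrite !om_def raddfB /=.
move: (phi (jord (jord x y) z)) (phi (jord x (jord y z))) (phi (jord x y))
  (phi (jord y z)) (om x y) (om y z) => a b c d e f h1 h2 h3 h4.
rewrite (_ : _ - _ = (a - ((e + mu x * mu y) * phi z + mu z * c))
  - (b - (mu x * d + (f + mu y * mu z) * phi x))
  + mu z * (c - (mu x * phi y + mu y * phi x))
  - mu x * (d - (mu y * phi z + mu z * phi y))); last first.
  apply: (use_eq (-1) (phi y) (cmu x (mu z))).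
  apply: (use_eq (-1) (phi x) (cmu y (mu z))).
  ncring.
by apply: centralB; [apply: centralD; [apply: centralB|apply: centralM]|apply: centralM].
Qed.

(** Since [y, [x^2, x]] = 0, the product of phi x with the difference of the
    two sides is central. This settles the case where phi x is not central,
    and the other case follows by the parallelogram law. *)
Lemma om_square x y : om (jord x x) y = (mu x * om x y) *+ 2.
Proof.
pose d x := om (jord x x) y - (mu x * om x y) *+ 2.
have cd z : central (d z).
  apply: centralB; first exact: om_central.
  by apply: centralMn; apply: centralM => //; apply: om_central.
have nc z : ~ central (phi z) -> d z = 0.
  apply: central_factor => //.
  have := phi_lie_lie y (jord z z) z.
  rewrite (_ : lie y (lie (jord z z) z) = 0); last by ncring.
  rewrite raddf0 => h1.
  have h2 := form z z.
  rewrite (_ : d z * phi z = - (0 - (om (jord z z) y * phi z - om y z * phi (jord z z)))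
    + om y z * (phi (jord z z) - (mu z * phi z + mu z * phi z))).
    apply: centralD; first exact: centralN.
    by apply: centralM => //; apply: om_central.
  rewrite /d (omC y z).
  apply: (use_eq (-1 *+ 2) (phi z) (cmu z (om z y))).
  ncring.
suff : d x = 0 by move/eqP; rewrite subr_eq0 => /eqP.
case: (pselect (central (phi x))) => [cx|/nc//].
have [x0 n0] := exists_noncentral.
have n1 : ~ central (phi (x0 + x)).
  move=> h; apply: n0; have := centralB h cx; rewrite raddfD /= addrK //.
have n2 : ~ central (phi (x0 - x)).
  move=> h; apply: n0; have := centralD h cx; rewrite raddfB /= subrK //.
have h1 := nc _ n1; have h2 := nc _ n2; have h0 := nc _ n0.
have par : d (x0 + x) + d (x0 - x) = d x0 + d x0 + (d x + d x).
  rewrite /d.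
  rewrite (_ : jord (x0 + x) (x0 + x)
      = jord x0 x0 + jord x x + jord x0 x + jord x0 x); last by ncring.
  rewrite (_ : jord (x0 - x) (x0 - x)
      = jord x0 x0 + jord x x - jord x0 x - jord x0 x); last by ncring.
  have muD a b : mu (a + b) = mu a + mu b := raddfD mu a b.
  have muB a : mu (- a) = - mu a := raddfN mu a.
  rewrite !(omDl, omNl, muD, muB); ncring.
by apply: (double_eq0 hf2); rewrite -[_ + _]add0r -[X in X + _]addr0 -{1 2}h0 -par h1 h2 addr0.
Qed.

Lemma om_jord x z y : om (jord x z) y = mu x * om z y + mu z * om x y.
Proof.
have := om_square (x + z) y.
rewrite (_ : jord (x + z) (x + z)
    = jord x x + jord z z + jord x z + jord x z); last by ncring.
have om4 a b c d : om (a + b + c + d) y = om a y + om b y + om c y + om d y.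
  by rewrite !omDl.
have muD : mu (x + z) = mu x + mu z := raddfD mu x z.
rewrite om4 muD (omDl x z) !om_square => e.
apply/eqP; rewrite -subr_eq0; apply/eqP/(double_eq0 hf2).
by apply: (use_eq 1 1 e); ncring.
Qed.

Lemma mu_lie_lie y x z : mu (lie y (lie x z)) = 0.
Proof.
rewrite (_ : lie y (lie x z) = jord (jord x y) z - jord x (jord y z)); last by ncring.
rewrite raddfB /= !om_def [om x (jord _ _)]omC !om_jord (omC y x) (omC z x).
apply: (use_eq (-1) 1 (cmu z (om x y))).
ncring.
Qed.

Lemma om_lie_lie y x z u :
  om (lie y (lie x z)) u = om x y * om z u - om y z * om x u.
Proof.
rewrite (_ : lie y (lie x z) = jord (jord x y) z - jord x (jord y z)); last by ncring.
rewrite omDl omNl !om_jord !om_def.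
apply: (use_eq (-1) (om y u) (cmu x (mu z))).
apply: (use_eq (-1) (om x u) (cmu y (mu z))).
ncring.
Qed.

Definition degenerate (x : A) : Prop :=
  [/\ central (phi x), mu x = 0 & forall y, om x y = 0].

Lemma degenerate_jordan_ideal : jordan_ideal degenerate.
Proof.
split.
- split; rewrite ?raddf0 //; first exact: central0.
  by move=> y; rewrite /om !(mul0r, mulr0) addr0 !raddf0 mul0r subr0.
- move=> x y [h1 h2 h3] [h4 h5 h6]; split.
  + by rewrite raddfD; apply: centralD.
  + by rewrite raddfD /= h2 h5 addr0.
  + by move=> z; rewrite omDl h3 h6 addr0.
- move=> x y [h1 h2 h3]; split.
  + have := centralD (form x y) (centralM (cmu y) h1).
    by rewrite h2 mul0r add0r subrK.
  + by rewrite om_def h3 h2 mul0r addr0.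
  + by move=> z; rewrite om_jord h2 h3 mul0r mulr0 addr0.
Qed.

Lemma degenerate_proper : ~ degenerate 1.
Proof. by case=> _ /mu1_neq0. Qed.

(** Double commutators have trace mu equal to zero. Jordan products s of such
    elements behave like scalars, in that phi s is central and om s vanishes,
    and the commutator of s with any commutator is then degenerate. In the
    quotients by ideals that contain the degenerate elements this says that s
    is central. *)
Lemma degenerate_identity x a b y c d u v :
  degenerate (lie (jord (lie x (lie a b)) (lie y (lie c d))) (lie u v)).
Proof.
have hp : mu (lie x (lie a b)) = 0 := mu_lie_lie x a b.
have hq : mu (lie y (lie c d)) = 0 := mu_lie_lie y c d.
move: (lie x _) (lie y _) hp hq => p q hp hq.
have cpq : central (phi (jord p q)).
  by have := form p q; rewrite hp hq !mul0r addr0 subr0.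
have opq z : om (jord p q) z = 0.
  by rewrite om_jord hp hq !mul0r addr0.
move: (jord p q) cpq opq => s cs os; split.
- have := phi_lie_lie s u v.
  by rewrite os (omC u) os !mul0r !subr0.
- exact: mu_lie_lie.
- by move=> z; rewrite om_lie_lie (omC u) !os !mul0r subr0.
Qed.

End DegenerateForm.

(** * Jordan homomorphisms up to the center *)

Section JordanModCenter.
Variables (A B : pzRingType) (Psi : {additive A -> B}).
Hypothesis tfB : forall n (x : B), x *+ n.+1 = 0 -> x = 0.
Hypothesis HB : generates_unit (@is_quad_defect B).
Hypothesis sB : semiprime B.
Hypothesis Psi_dense : forall b, exists x, central (b - Psi x).

Let PD x y : Psi (x + y) = Psi x + Psi y := raddfD Psi x y.
Let PN x : Psi (- x) = - Psi x := raddfN Psi x.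

Section Epsilon.

Definition eps (x y : A) : B := Psi (jord x y) - jord (Psi x) (Psi y).

Hypothesis eps_central : forall x y, central (eps x y).

Lemma epsDl x x' y : eps (x + x') y = eps x y + eps x' y.
Proof.
rewrite /eps (_ : jord (x + x') y = jord x y + jord x' y); last by ncring.
by rewrite !PD; ncring.
Qed.

Lemma epsNl x y : eps (- x) y = - eps x y.
Proof.
rewrite /eps (_ : jord (- x) y = - jord x y); last by ncring.
by rewrite !PN; ncring.
Qed.

(** Psi is applied to the Jordan identity (x^2 o y) o x = x^2 o (y o x). By
    the same identity in B the terms without eps cancel. *)
Lemma eps_jordan_identity x y :
  central (eps (jord x x) y * Psi x - eps x y *+ 2 * (Psi x * Psi x)).
Proof.
pose q := jord x x.
have Pq : Psi q = eps x x + jord (Psi x) (Psi x) by rewrite /eps subrK.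
have Pqy : Psi (jord q y) = eps q y + jord (Psi q) (Psi y) by rewrite /eps subrK.
have Pyx : Psi (jord y x) = eps y x + jord (Psi y) (Psi x) by rewrite /eps subrK.
have e1 : Psi (jord (jord q y) x) = eps (jord q y) x + jord (Psi (jord q y)) (Psi x).
  by rewrite /eps subrK.
have e2 : Psi (jord q (jord y x)) = eps q (jord y x) + jord (Psi q) (Psi (jord y x)).
  by rewrite /eps subrK.
have ee : jord (jord q y) x = jord q (jord y x) by rewrite /q; ncring.
have eyx : eps y x = eps x y.
  by rewrite /eps [y * x + _]addrC [Psi y * _ + _]addrC.
have e3 := etrans (esym e1) (etrans (congr1 Psi ee) e2).
rewrite -/q; rewrite Pqy Pyx Pq eyx in e3.
have c1 := eps_central q y (Psi x); have c2 := eps_central x y (Psi x * Psi x).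
have c3 z := eps_central x x z.
have two (z : B) : central (z + z) -> central z.
  move=> cz w; apply/eqP; rewrite -subr_eq0; apply/eqP/(@tfB 1).
  by rewrite mulr2n; apply: (use_eq 1 1 (cz w)); ncring.
apply: two.
move: (eps_central (jord q y) x) (eps_central q (jord y x)) c1 c2 c3 e3.
move: (eps_central x x) (eps_central x y).
move: (eps (jord q y) x) (eps q (jord y x)) (eps q y) (eps x y) (eps x x).
move: (Psi x) (Psi y) => P Y a b c d f cf cd ca cb c1 c2 c3 e3.
rewrite (_ : _ + _ = b - a + f * d *+ 2).
  by apply: centralD; [exact: centralB | apply/centralMn/centralM].
apply: (use_eq 1 1 e3).
apply: (use_eq 1 1 c1).
apply: (use_eq (-1 *+ 2) 1 c2).
apply: (use_eq (-1) 1 (cf d)).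
apply: (use_eq (- Y) 1 (cf P)).
apply: (use_eq 1 Y (cf P)).
ncring.
Qed.

(** By the previous lemma 2 eps x y * Psi x ^ 2 is a central multiple of Psi x
    modulo the center, and the map whose value at Psi x ^ 2 is the defect
    annihilates 1 and Psi x. *)
Lemma eps_defect x y w u v : eps x y * quad_defect (Psi x) w u v = 0.
Proof.
apply: (@tfB 1).
have ce := eps_jordan_identity x y.
have c1 := eps_central x y; have c2 := eps_central (jord x x) y.
move: (eps x y) (eps _ y) (Psi x) ce c1 c2 => a b t ce ca cb.
rewrite /quad_defect.
apply: (use_eq (-1) (u * lie t v) (ce w)).
apply: (use_eq (lie t w * u) 1 (ce v)).
apply: (use_eq (-1 *+ 2) (t * t * u * lie t v) (ca w)).
apply: (use_eq 1 (t * u * lie t v) (cb w)).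
apply: (use_eq (-1 *+ 2) (t * t * v) (ca (lie t w * u))).
apply: (use_eq (1 *+ 2) (t * t) (ca (lie t w * u * v))).
apply: (use_eq 1 (t * v) (cb (lie t w * u))).
apply: (use_eq (-1) t (cb (lie t w * u * v))).
ncring.
Qed.

(** The products eps (x + k x0) y * D (Psi x + k Psi x0), with D a defect,
    vanish for all integers k. Comparing coefficients of k^3 gives eps x y * D
    (Psi x0) = - eps x0 y * D2. As eps x0 y annihilates D (Psi x0), the
    element eps x y * D (Psi x0) has sandwich square zero. So eps x y
    annihilates all defects. *)
Lemma eps_zero x y : eps x y = 0.
Proof.
have ann x0 w u v : eps x y * quad_defect (Psi x0) w u v = 0.
  pose D t := quad_defect t w u v.
  have c0 := eps_central x0 y; have c1 := eps_central x y.
  have h (z : A) : eps z y * D (Psi z) = 0 by apply: eps_defect.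
  have e0 := h x0; have e1 := h x.
  have ep1 := h (x + x0); have em1 := h (x - x0).
  have ep2 := h (x + (x0 + x0)); have em2 := h (x - (x0 + x0)).
  rewrite !(epsDl, epsNl, PD, PN) in ep1 em1 ep2 em2.
  move: (eps x y) (eps x0 y) (Psi x) (Psi x0) c0 c1 e0 e1 ep1 em1 ep2 em2
    => a b s t cb ca e0 e1 ep1 em1 ep2 em2 {h}.
  rewrite -/(D t).
  (* the coefficient of k ^ 2 in D (s + k t) *)
  pose D2 := lie (t * t) w * u * lie s v + lie (jord s t) w * u * lie t v
    - lie t w * u * lie (jord s t) v - lie s w * u * lie (t * t) v.
  have h3 : a * D t = - (b * D2).
    apply/eqP; rewrite -subr_eq0; apply/eqP/(@tfB 11).
    apply: (use_eq 1 1 ep2).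
    apply: (use_eq (-1) 1 em2).
    apply: (use_eq (-1 *+ 2) 1 ep1).
    apply: (use_eq (1 *+ 2) 1 em1).
    rewrite /D /D2 /quad_defect; ncring.
  apply: sB => z.
  rewrite [a * D t in X in X * _ * _]h3.
  apply: (use_eq (- (D2 * z * a)) 1 e0).
  apply: (use_eq (-1) (a * D t) (cb (D2 * z))).
  apply: (use_eq (- (D2 * z)) (D t) (cb a)).
  ncring.
rewrite -[eps x y]mulr1.
have c1 := eps_central x y; move: (eps x y) c1 ann => a ca ann.
apply: (HB (I := fun c => a * c = 0)) => [|_ [t [w [u [v ->]]]]].
  split=> [|c d hc hd|c z d hz]; first by rewrite mulr0.
    by rewrite mulrDr hc hd addr0.
  by rewrite !mulrA ca -[c * a * z]mulrA hz mulr0 mul0r.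
have [x0 cx0] := Psi_dense t.
rewrite -(ann x0 w u v) /quad_defect.
move: (Psi x0) cx0 => r; have -> : t = (t - r) + r by rewrite subrK.
move: (t - r) => z; rewrite addrK => cz.
congr (a * _).
have l1 x0' : lie (z + r) x0' = lie r x0'.
  by apply: (use_eq 1 1 (cz x0')); ncring.
have l2 x0' : lie ((z + r) * (z + r)) x0' = lie (r * r) x0' + (z * lie r x0') *+ 2.
  apply: (use_eq z 1 (cz x0')).
  apply: (use_eq 1 z (cz x0')).
  apply: (use_eq (-1) x0' (cz r)).
  apply: (use_eq 1 r (cz x0')).
  apply: (use_eq 1 1 (cz (x0' * r))).
  ncring.
rewrite !l1 !l2.
apply: (use_eq (1 *+ 2) (lie r v) (cz (lie r w * u))).
ncring.
Qed.
End Epsilon.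

Section JordanHom.
Hypothesis PJ : forall x y, Psi (jord x y) = jord (Psi x) (Psi y).

Lemma lie_dense a b : exists x y, lie a b = lie (Psi x) (Psi y).
Proof.
have [x cx] := Psi_dense a; have [y cy] := Psi_dense b; exists x, y.
apply: (use_eq 1 1 (cx b)).
apply: (use_eq (-1) 1 (cy (Psi x))).
ncring.
Qed.

Lemma double_inj (x : B) : x + x = 0 -> x = 0.
Proof. by rewrite -mulr2n; apply: (@tfB 1). Qed.

(** The image of 1 is an idempotent that acts as a unit on the image of Psi.
    It is therefore central, and 1 - Psi 1 annihilates all commutators. *)
Lemma jordan_unit : Psi 1 = 1.
Proof.
pose f := Psi 1.
have fx x : jord f (Psi x) = Psi x + Psi x.
  by rewrite -PJ !mul1r !mulr1 PD.
have ff : f * f = f.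
  apply/eqP; rewrite -subr_eq0; apply/eqP/double_inj.
  by apply: (use_eq 1 1 (fx 1)); rewrite -/f; ncring.
have f1 x : f * Psi x * f = f * Psi x.
  apply: (use_eq f 1 (fx x)).
  by apply: (use_eq (-1) (Psi x) ff); ncring.
have f2 x : f * Psi x * f = Psi x * f.
  apply: (use_eq 1 f (fx x)).
  by apply: (use_eq (- Psi x) 1 ff); ncring.
have f3 x : f * Psi x = Psi x.
  apply/eqP; rewrite -subr_eq0; apply/eqP/double_inj.
  apply: (use_eq 1 1 (fx x)).
  apply: (use_eq 1 1 (f2 x)).
  apply: (use_eq (-1) 1 (f1 x)).
  ncring.
have cf : central f.
  move=> b; have [x cx] := Psi_dense b.
  apply: (use_eq (-1) 1 (cx f)).
  apply: (use_eq (-1) 1 (f1 x)).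
  apply: (use_eq 1 1 (f2 x)).
  ncring.
have : 1 - f = 0.
  apply: (kills_commutators HB); first by apply: centralB => //; apply: central1.
  move=> a b; have [x [y ->]] := lie_dense a b.
  apply: (use_eq (-1) (Psi y) (f3 x)).
  apply: (use_eq 1 (Psi x) (f3 y)).
  ncring.
by move/eqP; rewrite subr_eq0 => /eqP.
Qed.

(** 4 x y x = 2 x o (x o y) - (x o x) o y. *)
Lemma jordan_triple x y : Psi (x * y * x) = Psi x * Psi y * Psi x.
Proof.
apply/eqP; rewrite -subr_eq0; apply/eqP/double_inj/double_inj.
have e1 : Psi (jord x (jord x y)) = jord (Psi x) (jord (Psi x) (Psi y)).
  by rewrite PJ (PJ x y).
have e2 : Psi (jord (jord x x) y) = jord (jord (Psi x) (Psi x)) (Psi y).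
  by rewrite PJ (PJ x x).
have : Psi (jord x (jord x y)) + Psi (jord x (jord x y)) - Psi (jord (jord x x) y)
   = Psi (x * y * x) *+ 4.
  have P4 a : Psi (a + a + (a + a)) = Psi a *+ 4 by rewrite !PD; ncring.
  by rewrite -P4 -PN -!PD; congr (Psi _); ncring.
rewrite e1 e2 => e.
by apply: (use_eq (-1) 1 e); ncring.
Qed.

Definition hom_defect x y := Psi (x * y) - Psi x * Psi y.
Definition antihom_defect x y := Psi (x * y) - Psi y * Psi x.
Local Notation p := hom_defect.
Local Notation q := antihom_defect.

Lemma hom_defectDl x x' y : p (x + x') y = p x y + p x' y.
Proof. by rewrite /hom_defect mulrDl !PD; ncring. Qed.
Lemma hom_defectDr x y y' : p x (y + y') = p x y + p x y'.
Proof. by rewrite /hom_defect mulrDr !PD; ncring. Qed.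
Lemma antihom_defectDl x x' y : q (x + x') y = q x y + q x' y.
Proof. by rewrite /antihom_defect mulrDl !PD; ncring. Qed.
Lemma antihom_defectDr x y y' : q x (y + y') = q x y + q x y'.
Proof. by rewrite /antihom_defect mulrDr !PD; ncring. Qed.

(** The element (x y) z (y x) + (y x) z (x y) is a Jordan triple product of x
    y, z and y x, and it is also x (y z y) x + y (x z x) y. The two ways of
    computing its image give the claim for b in the image of Psi; modulo the
    center these are all the elements of B. *)
Lemma defects_anticommute x y b : p x y * b * q x y + q x y * b * p x y = 0.
Proof.
have yx : Psi (y * x) = Psi x * Psi y + Psi y * Psi x - Psi (x * y).
  by have := PJ x y; rewrite PD => e; apply: (use_eq 1 1 e); ncring.
have img z : p x y * Psi z * q x y + q x y * Psi z * p x y = 0.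
  have tr r s t : Psi (r * s * t + t * s * r) = Psi r * Psi s * Psi t + Psi t * Psi s * Psi r.
    rewrite (_ : _ + _ = (r + t) * s * (r + t) - r * s * r - t * s * t); last by ncring.
    rewrite !PD !PN !jordan_triple !PD; ncring.
  have := tr (x * y) z (y * x).
  rewrite (_ : _ + _ = x * (y * z * y) * x + y * (x * z * x) * y); last by ncring.
  rewrite PD !jordan_triple yx => e.
  rewrite /hom_defect /antihom_defect.
  apply: (use_eq 1 1 e); ncring.
have [z cz] := Psi_dense b.
have := img z; have := img 1; rewrite jordan_unit.
move: (p x y) (q x y) => a c e1 e2.
apply: (use_eq 1 1 e2).
apply: (use_eq (b - Psi z) 1 e1).
apply: (use_eq (-1) c (cz a)).
apply: (use_eq (-1) a (cz c)).
ncring.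
Qed.

Lemma anticommuting_orthogonal (a c : B) :
  (forall b, a * b * c + c * b * a = 0) -> forall b, a * b * c = 0.
Proof.
move=> e b; apply: sB => d; apply: double_inj.
(* the two sides of a b (a d c) b c = - a b (c d a) b c are plus and minus
   the word a b c d a b c *)
apply: (use_eq (a * b) (b * c) (e d)).
apply: (use_eq (-1) (b * c) (e (b * a * d))).
apply: (use_eq 1 (d * a * b * c) (e b)).
ncring.
Qed.

(** Starting from equal arguments, one variable is polarized at a time. In
    each step the sandwich square of the product in question contains a
    product that vanishes by the step before. *)
Lemma defects_orthogonal x y u v b : p x y * b * q u v = 0 /\ q u v * b * p x y = 0.
Proof.
have pq x0 y0 c : p x0 y0 * c * q x0 y0 = 0.
  by apply: anticommuting_orthogonal => d; apply: defects_anticommute.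
have qp x0 y0 c : q x0 y0 * c * p x0 y0 = 0.
  apply: anticommuting_orthogonal => d; rewrite addrC; exact: defects_anticommute.
have pq1 x0 y0 v0 c : p x0 y0 * c * q x0 v0 = 0.
  have e d : p x0 y0 * d * q x0 v0 + p x0 v0 * d * q x0 y0 = 0.
    have := pq x0 (y0 + v0) d; rewrite hom_defectDr antihom_defectDr => e.
    apply: (use_eq 1 1 e).
    apply: (use_eq (-1) 1 (pq x0 y0 d)).
    apply: (use_eq (-1) 1 (pq x0 v0 d)).
    ncring.
  apply: sB => d.
  apply: (use_eq (p x0 y0 * c * q x0 v0 * d) 1 (e c)).
  apply: (use_eq (- (p x0 y0 * c)) (c * q x0 y0) (qp x0 v0 d)).
  ncring.
have qp1 x0 y0 v0 c : q x0 y0 * c * p x0 v0 = 0.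
  have e d : q x0 y0 * d * p x0 v0 + q x0 v0 * d * p x0 y0 = 0.
    have := qp x0 (y0 + v0) d; rewrite hom_defectDr antihom_defectDr => e.
    apply: (use_eq 1 1 e).
    apply: (use_eq (-1) 1 (qp x0 y0 d)).
    apply: (use_eq (-1) 1 (qp x0 v0 d)).
    ncring.
  apply: sB => d.
  apply: (use_eq (q x0 y0 * c * p x0 v0 * d) 1 (e c)).
  apply: (use_eq (- (q x0 y0 * c)) (c * p x0 y0) (pq x0 v0 d)).
  ncring.
split.
- have e d : p x y * d * q u v + p u y * d * q x v = 0.
    have := pq1 (x + u) y v d; rewrite hom_defectDl antihom_defectDl => e.
    apply: (use_eq 1 1 e).
    apply: (use_eq (-1) 1 (pq1 x y v d)).
    apply: (use_eq (-1) 1 (pq1 u y v d)).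
    ncring.
  apply: sB => d.
  apply: (use_eq (p x y * b * q u v * d) 1 (e b)).
  apply: (use_eq (- (p x y * b)) (b * q x v) (qp1 u v y d)).
  ncring.
- have e d : q u v * d * p x y + q x v * d * p u y = 0.
    have := qp1 (x + u) v y d; rewrite hom_defectDl antihom_defectDl => e.
    apply: (use_eq 1 1 e).
    apply: (use_eq (-1) 1 (qp1 x v y d)).
    apply: (use_eq (-1) 1 (qp1 u v y d)).
    ncring.
  apply: sB => d.
  apply: (use_eq (q u v * b * p x y * d) 1 (e b)).
  apply: (use_eq (- (q u v * b)) (b * p u y) (pq1 x y v d)).
  ncring.
Qed.

(** The two kinds of defects generate ideals that annihilate each other. Since
    q x y - p x y = [Psi x, Psi y], their sum contains all commutators and
    hence 1, and e is the component of 1 in the ideal of the q x y. *)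
Theorem jordan_direct_sum : exists e : B, [/\ central e, e * e = e,
  forall x y, e * Psi (x * y) = e * Psi x * Psi y
  & forall x y, (1 - e) * Psi (x * y) = (1 - e) * Psi y * Psi x].
Proof.
pose I (x : B) := forall u v c, x * c * q u v = 0 /\ q u v * c * x = 0.
pose J (x : B) := forall i c, I i -> x * c * i = 0 /\ i * c * x = 0.
have Ip x y : I (p x y) by move=> u v c; apply: defects_orthogonal.
have Jq x y : J (q x y) by move=> i c /(_ x y c)[].
have tI : two_sided I.
  split=> [u v c|x y hx hy u v c|a x b hx u v c].
  - by rewrite !(mul0r, mulr0).
  - have [h1 h2] := hx u v c; have [h3 h4] := hy u v c.
    split; [rewrite mulrDl mulrDl h1 h3 | rewrite mulrDr h2 h4]; exact: addr0.
  - have [h1 _] := hx u v (b * c); have [_ h2] := hx u v (c * a); split.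
      by apply: (use_eq a 1 h1); ncring.
    by apply: (use_eq 1 b h2); ncring.
have tJ : two_sided J.
  split=> [i c hi|x y hx hy i c hi|a x b hx i c hi].
  - by rewrite !(mul0r, mulr0).
  - have [h1 h2] := hx i c hi; have [h3 h4] := hy i c hi.
    split; [rewrite mulrDl mulrDl h1 h3 | rewrite mulrDr h2 h4]; exact: addr0.
  - have [h1 _] := hx i (b * c) hi; have [_ h2] := hx i (c * a) hi; split.
      by apply: (use_eq a 1 h1); ncring.
    by apply: (use_eq 1 b h2); ncring.
have [I0 ID IM] := tI; have [J0 JD JM] := tJ.
have [i [e [Ii Je ie]]] : exists i e : B, [/\ I i, J e & i + e = 1].
  apply: (commutators_generate HB (I := fun c => exists i e : B, [/\ I i, J e & i + e = c])).
    split.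
    - by exists 0, 0; rewrite addr0.
    - move=> _ _ [i [e [h1 h2 <-]]] [i' [e' [h3 h4 <-]]].
      by exists (i + i'), (e + e'); rewrite addrACA; split=> //; [exact: ID|exact: JD].
    - move=> a _ b [i [e [h1 h2 <-]]]; exists (a * i * b), (a * e * b).
      by rewrite mulrDr mulrDl; split=> //; [exact: IM|exact: JM].
  move=> _ [a [b ->]]; have [x [y ->]] := lie_dense a b.
  exists (- p x y), (q x y); split; [exact: (two_sided_opp tI (Ip x y)) | exact: Jq |].
  by rewrite /hom_defect /antihom_defect; ncring.
have iE : 1 - e = i by rewrite -ie addrK.
have ei b : e * b * i = 0 by have [] := Je i b Ii.
have ie0 b : i * b * e = 0 by have [_] := Je i b Ii.
exists e; split.
- move=> b; rewrite -iE in ei ie0.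
  apply: (use_eq 1 1 (ei b)).
  by apply: (use_eq (-1) 1 (ie0 b)); ncring.
- by have := ei 1; rewrite mulr1 -iE => h; apply: (use_eq (-1) 1 h); ncring.
- move=> x y; have [h _] := Je _ 1 (Ip x y).
  by rewrite mulr1 /hom_defect in h; apply: (use_eq 1 1 h); ncring.
- move=> x y; have [h _] := Ii x y 1; rewrite iE.
  by rewrite mulr1 /antihom_defect in h; apply: (use_eq 1 1 h); ncring.
Qed.

End JordanHom.

(** The image of Psi is known only up to the center, but [a, b] z = [a z, b]
    for central z. So the elements c for which all e c z, with z central,
    belong to the image form an ideal that contains all commutators. The
    multiplication m is a parameter so that the opposite product of A can be
    used for the other summand. *)
Lemma direct_sum_half_surj (m : A -> A -> A) (e f : B) :
  central e -> central f -> e + f = 1 -> e * f = 0 ->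
  (forall x y, e * Psi (m x y) = e * Psi x * Psi y) ->
  (forall x y, f * Psi (m x y) = f * Psi y * Psi x) ->
  forall b, exists x, Psi x = e * b.
Proof.
move=> ce cf ef1 ef hm ha.
have PsiE z : Psi z = e * Psi z + f * Psi z by rewrite -mulrDl ef1 mul1r.
have fe : f * e = 0 by rewrite (cf e) ef.
have ee : e * e = e.
  by apply: (use_eq e 1 ef1); apply: (use_eq (-1) 1 ef); ncring.
pose G (c : B) := forall z, central z -> exists x, Psi x = e * c * z.
have tG : two_sided G.
  have mullG a c : G c -> G (a * c).
    move=> hc z cz; have [y cy] := Psi_dense a.
    have [x hx] := hc z cz; have [x' hx'] := hc _ (centralM cy cz).
    exists (m y x + x'); rewrite PD hx' [Psi (m y x)]PsiE hm ha hx.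
    apply: (use_eq (- e) z (cy c)).
    apply: (use_eq (- e) (c * z) (ce (Psi y))).
    apply: (use_eq 1 (Psi y * c * z) ee).
    apply: (use_eq 1 (c * z * Psi y) fe).
    ncring.
  have mulrG a c : G c -> G (c * a).
    move=> hc z cz; have [y cy] := Psi_dense a.
    have [x hx] := hc z cz; have [x' hx'] := hc _ (centralM cy cz).
    exists (m x y + x'); rewrite PD hx' [Psi (m x y)]PsiE hm ha hx.
    apply: (use_eq 1 (c * z * Psi y) ee).
    apply: (use_eq (e * c) 1 (cz (Psi y))).
    apply: (use_eq (- f) (c * z) (ce (Psi y))).
    apply: (use_eq 1 (Psi y * c * z) fe).
    ncring.
  split.
  - by move=> z _; exists 0; rewrite raddf0 mulr0 mul0r.
  - move=> c d hc hd z cz; have [x hx] := hc z cz; have [y hy] := hd z cz.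
    by exists (x + y); rewrite PD hx hy; ncring.
  - by move=> a c b hc; apply/mulrG/mullG.
have G1 : G 1.
  apply: (commutators_generate HB tG) => _ [a [b ->]] z cz.
  have [x cx] := Psi_dense (e * (a * z)); have [y cy] := Psi_dense b.
  exists (m x y - m y x); rewrite PD PN [Psi (m x y)]PsiE [Psi (m y x)]PsiE !hm !ha.
  apply: (use_eq (f - e) 1 (cx (Psi y))).
  apply: (use_eq (e - f) 1 (cy (e * (a * z)))).
  apply: (use_eq 1 (a * z * b) ee).
  apply: (use_eq (e * a) 1 (cz b)).
  apply: (use_eq (e - f) (a * z) (ce b)).
  apply: (use_eq (-1) (b * a * z) ee).
  apply: (use_eq (-1) (a * z * b) fe).
  apply: (use_eq 1 (b * a * z) fe).
  ncring.
move=> b; have [x hx] := two_sided_mull b tG G1 1 (@central1 B).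
by exists x; rewrite hx !mulr1.
Qed.
End JordanModCenter.

(** * Nonemptiness of the spectrum *)

Section Spectrum.
Local Open Scope classical_set_scope.
Variables (R : realType) (Q : pzRingType) (k : {rmorphism R[i] -> Q}) (p : Q -> R).
Hypothesis kC : forall c, central (k c).
Hypothesis p_ge0 : forall x, 0 <= p x.
Hypothesis pD : forall x y, p (x + y) <= p x + p y.
Hypothesis pM : forall x y, p (x * y) <= p x * p y.
Hypothesis pR : forall (a : R) x, p (k a%:C%C * x) <= `|a| * p x.
Hypothesis pI : forall x, p (k 'i%C * x) <= p x.
Hypothesis p1 : 0 < p 1.

Let kr (a : R) : Q := k a%:C%C.
Let j : Q := k 'i%C.

Lemma krM a b : kr (a * b) = kr a * kr b.
Proof. by rewrite /kr !rmorphM. Qed.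
Lemma krB a b : kr (a - b) = kr a - kr b.
Proof. by rewrite /kr !rmorphB. Qed.
Lemma krD a b : kr (a + b) = kr a + kr b.
Proof. by rewrite /kr !rmorphD. Qed.
Lemma krN a : kr (- a) = - kr a.
Proof. by rewrite /kr !rmorphN. Qed.
Lemma kr1 : kr 1 = 1.
Proof. by rewrite /kr !rmorph1. Qed.
Lemma imag_sq : j * j = -1.
Proof. by rewrite /j -rmorphM -expr2 sqr_i rmorphN rmorph1. Qed.

Lemma kr_inverse (a b : R) : a ^+ 2 + b ^+ 2 != 0 ->
  (kr (a / (a ^+ 2 + b ^+ 2)) + kr (- b / (a ^+ 2 + b ^+ 2)) * j) * (kr a + kr b * j) = 1.
Proof.
move=> n0; set n := a ^+ 2 + b ^+ 2.
have hN : kr n^-1 * (kr a * kr a + kr b * kr b) = 1.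
  by rewrite -!krM -krD -krM -kr1; congr kr; rewrite -!expr2 mulVf.
have cj x : kr x * j = j * kr x by apply: kC.
have cr u v : kr u * kr v = kr v * kr u by apply: kC.
rewrite mulNr krN !krM.
apply: (use_eq 1 1 hN).
apply: (use_eq 1 (kr a + kr b * j) (cr a n^-1)).
apply: (use_eq (-1) (j * (kr a + kr b * j)) (cr b n^-1)).
apply: (use_eq (kr n^-1 * kr b) 1 (cj a)).
apply: (use_eq (kr n^-1) j (cr a b)).
apply: (use_eq (kr n^-1 * kr b) j (cj b)).
apply: (use_eq (- (kr n^-1 * kr b * kr b)) 1 imag_sq).
ncring.
Qed.

Variables (z : Q) (y : R * R -> Q).
Hypothesis yr : forall w, (z - kr w.1 - kr w.2 * j) * y w = 1.
Hypothesis yl : forall w, y w * (z - kr w.1 - kr w.2 * j) = 1.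

Let f w := p (y w).

Lemma pN x : p (- x) <= p x.
Proof. by have := pR (-1) x; rewrite -/(kr _) krN kr1 mulN1r normrN1 mul1r. Qed.

Lemma pRI a b x : p ((kr a + kr b * j) * x) <= (`|a| + `|b|) * p x.
Proof.
rewrite mulrDl; apply: (le_trans (pD _ _)); rewrite mulrDl.
apply: lerD; first exact: pR.
rewrite -[kr b * j * x]mulrA; apply: (le_trans (pR _ _)); apply: ler_wpM2l => //.
Qed.

Lemma resolvent_step w w' :
  f w' <= f w + (`|w'.1 - w.1| + `|w'.2 - w.2|) * (f w' * f w).
Proof.
have e : y w' = y w + (kr (w'.1 - w.1) + kr (w'.2 - w.2) * j) * (y w' * y w).
  have h1 := yl w'; have h2 := yr w.
  rewrite !krB.
  apply: (use_eq 1 (y w) h1).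
  apply: (use_eq (- y w') 1 h2).
  have c1 := kC (w'.1)%:C%C (y w'); rewrite -/(kr _) in c1.
  have c2 := kC (w.1)%:C%C (y w'); rewrite -/(kr _) in c2.
  have c3 : kr w'.2 * j * y w' = y w' * (kr w'.2 * j).
    by rewrite /kr /j -rmorphM kC.
  have c4 : kr w.2 * j * y w' = y w' * (kr w.2 * j).
    by rewrite /kr /j -rmorphM kC.
  apply: (use_eq (-1) (y w) c1).
  apply: (use_eq 1 (y w) c2).
  apply: (use_eq (-1) (y w) c3).
  apply: (use_eq 1 (y w) c4).
  ncring.
rewrite {1}/f e; apply: (le_trans (pD _ _)); rewrite lerD2l.
apply: (le_trans (pRI _ _ _)); apply: ler_wpM2l => //.
by rewrite addr_ge0.
Qed.

Lemma resolvent_gt0 w : 0 < f w.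
Proof.
rewrite lt_def p_ge0 andbT; apply/eqP => f0.
have := pM (z - kr w.1 - kr w.2 * j) (y w).
by rewrite yr -/(f w) f0 mulr0 leNgt p1.
Qed.

Lemma resolvent_continuous : continuous f.
Proof.
move=> w; apply/cvgrPdist_lt => e e0.
have f0 := resolvent_gt0 w.
pose d := Num.min (4 * f w)^-1 (e / (4 * f w ^+ 2)).
have d0 : 0 < d.
  by rewrite lt_min invr_gt0 divr_gt0 ?mulr_gt0 ?exprn_gt0.
apply/(@nbhs_ballP R (R * R)%type); exists d => // w' [/= h1 h2].
rewrite -ball_normE /= in h1; rewrite -ball_normE /= in h2.
have s1 := resolvent_step w w'; have s2 := resolvent_step w' w.
rewrite distrC in h1; rewrite distrC in h2.
rewrite (distrC w.1) (distrC w.2) in s2.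
move: (`|w'.1 - w.1|) (`|w'.2 - w.2|)
  (normr_ge0 (w'.1 - w.1)) (normr_ge0 (w'.2 - w.2)) h1 h2 s1 s2.
move=> a b a0 b0; rewrite !lt_min => /andP[a1 a2] /andP[b1 b2].
rewrite ltr_pdivlMr ?mulr_gt0 ?exprn_gt0 // in a2.
rewrite ltr_pdivlMr ?mulr_gt0 ?exprn_gt0 // in b2.
have {}a1 : a * (4 * f w) < 1 by rewrite -ltr_pdivlMr ?mulr_gt0 // mul1r.
have {}b1 : b * (4 * f w) < 1 by rewrite -ltr_pdivlMr ?mulr_gt0 // mul1r.
have f0' := resolvent_gt0 w'.
move=> s1 s2.
have u : f w' < 2 * f w by nra.
have v : (a + b) * (f w' * f w) < e by nra.
rewrite ltr_norml; apply/andP; split; lra.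
Unshelve. all: by end_near.
Qed.

(** If w stands for the scalar c, then c (y w) = z (y w) - 1. *)
Lemma resolvent_small (L : R) w : 0 < L -> 4 * p z <= L -> L <= `|w.1| \/ L <= `|w.2| ->
  f w <= 4 * p 1 / L.
Proof.
move=> L0 Lz Lw.
pose n := w.1 ^+ 2 + w.2 ^+ 2.
have n0 : 0 < n /\ (`|w.1| + `|w.2|) * L <= 2 * n.
  have e1 : w.1 ^+ 2 = `|w.1| ^+ 2 by rewrite real_normK // num_real.
  have e2 : w.2 ^+ 2 = `|w.2| ^+ 2 by rewrite real_normK // num_real.
  rewrite /n e1 e2; move: (`|w.1|) (`|w.2|) (normr_ge0 w.1) (normr_ge0 w.2) Lw => a b a0 b0 Lw.
  by case: Lw => Lw; split; move: (sqr_ge0 (a - b)) (sqr_ge0 a) (sqr_ge0 b); nra.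
case: n0 => n0 nL.
have e : y w = (kr (w.1 / n) + kr (- w.2 / n) * j) * (z * y w - 1).
  have h : (kr w.1 + kr w.2 * j) * y w = z * y w - 1.
    by apply: (use_eq (-1) 1 (yr w)); ncring.
  rewrite -h mulrA -[LHS]mul1r; congr (_ * _).
  by rewrite kr_inverse // gt_eqF.
have h : f w <= 2 / L * (p z * f w + p 1).
  rewrite {1}/f e; apply: (le_trans (pRI _ _ _)).
  apply: ler_pM => //; first by rewrite addr_ge0.
    rewrite ler_pdivlMr // !normrM normrN normfV (gtr0_norm n0) -mulrDl.
    by rewrite mulrAC ler_pdivrMr.
  apply: (le_trans (pD _ _)); apply: lerD; [exact: pM | exact: pN].
have f0 := resolvent_gt0 w.
rewrite ler_pdivlMr //.
have : f w * L <= 2 * (p z * f w + p 1) by rewrite -ler_pdivlMr // mulrAC.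
nra.
Qed.

Lemma geometric4 (t u v : Q) : v = u + t * v * u ->
  v = u + t * u * u + t * t * u * u * u + t * t * t * u * u * u * u
      + t * t * t * t * v * u * u * u * u.
Proof.
move=> h.
apply: (use_eq 1 1 h).
apply: (use_eq t u h).
apply: (use_eq (t * t) (u * u) h).
apply: (use_eq (t * t * t) (u * u * u) h).
ncring.
Qed.

(** The four points are c + r w with w^4 = 1. In the sum of the geometric
    expansions of the resolvents at these points only the powers of r
    divisible by four survive. *)
Lemma resolvent_mean (a b r : R) : 4 * f (a, b) <=
  (f (a + r, b) + f (a - r, b) + f (a, b + r) + f (a, b - r)) * (1 + r ^+ 4 * f (a, b) ^+ 4).
Proof.
pose u := y (a, b).
have step (a' b' : R) (t : Q) : kr a' + kr b' * j = kr a + kr b * j + t ->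
    (forall x, t * x = x * t) -> y (a', b') = u + t * y (a', b') * u.
  move=> ht ct; have h1 := yl (a', b'); have h2 := yr (a, b); rewrite /= in h1 h2.
  have h3 : t = kr a' + kr b' * j - kr a - kr b * j by rewrite ht; ncring.
  apply: (use_eq (- y (a', b')) 1 h2).
  apply: (use_eq 1 u h1).
  apply: (use_eq (-1) u (ct (y (a', b')))).
  apply: (use_eq (- y (a', b')) u h3).
  rewrite /u; ncring.
have crj x : kr r * j * x = x * (kr r * j) by rewrite /kr /j -rmorphM kC.
have h1 := geometric4 (step (a + r) b (kr r) _ (kC _)).
have h2 := geometric4 (step (a - r) b (- kr r) _ (centralN (kC _))).
have h3 := geometric4 (step a (b + r) (kr r * j) _ crj).
have h4 := geometric4 (step a (b - r) (- (kr r * j)) _ (centralN crj)).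
rewrite krD in h1; rewrite krB in h2; rewrite krD in h3; rewrite krB in h4.
have {}h1 := h1 ltac:(ncring).
have {}h2 := h2 ltac:(ncring).
have {}h3 := h3 ltac:(ncring).
have {}h4 := h4 ltac:(ncring).
have TT : kr r * j * (kr r * j) = - (kr r * kr r).
  have cj : kr r * j = j * kr r by apply: kC.
  apply: (use_eq (kr r * kr r) 1 imag_sq).
  apply: (use_eq (- kr r) j cj).
  ncring.
pose S := y (a + r, b) + y (a - r, b) + y (a, b + r) + y (a, b - r).
have hS : S = u *+ 4 + kr (r ^+ 4) * (S * (u * u * u * u)).
  have -> : kr (r ^+ 4) = kr r * kr r * kr r * kr r.
    by rewrite -!krM; congr kr; ring.
  rewrite /S; move: h1 h2 h3 h4 TT.
  move: (kr r * j) => T; move: (kr r) (y (a + r, b)) (y (a - r, b))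
    (y (a, b + r)) (y (a, b - r)).
  move=> r' y1 y2 y3 y4 h1 h2 h3 h4 TT.
  apply: (use_eq 1 1 h1).
  apply: (use_eq 1 1 h2).
  apply: (use_eq 1 1 h3).
  apply: (use_eq 1 1 h4).
  apply: (use_eq (1 *+ 2) (u * u * u) TT).
  apply: (use_eq (T * T) ((y3 + y4) * u * u * u * u) TT).
  apply: (use_eq (-1) (r' * r' * (y3 + y4) * u * u * u * u) TT).
  ncring.
have pS : p S <= f (a + r, b) + f (a - r, b) + f (a, b + r) + f (a, b - r).
  by rewrite /S; do 3!(apply: (le_trans (pD _ _)); rewrite lerD2r).
have p4 : 4 * f (a, b) <= p (u *+ 4).
  have hu : u = kr 4^-1 * (u *+ 4).
    rewrite mulrnAr -mulrnAl (_ : kr 4^-1 *+ 4 = 1) ?mul1r //.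
    have kr4 x : kr x *+ 4 = kr (x *+ 4).
      by rewrite (_ : x *+ 4 = x + x + x + x) ?krD; [ncring | ncring].
    by rewrite kr4 -kr1; congr kr; rewrite -[LHS]mulr_natr mulVf ?pnatr_eq0.
  have := pR 4^-1 (u *+ 4); rewrite -/(kr _) -hu -/(f (a, b)) ger0_norm ?invr_ge0 ?ler0n //.
  by rewrite mulrC ler_pdivlMr // mulrC.
have pu : p (u * u * u * u) <= f (a, b) ^+ 4.
  rewrite !exprS expr0 mulr1 !mulrA.
  do 2!(apply: (le_trans (pM _ _)); apply: ler_wpM2r; first exact: p_ge0).
  exact: pM.
apply: (le_trans p4).
have -> : u *+ 4 = S + kr (- r ^+ 4) * (S * (u * u * u * u)).
  by rewrite krN; apply: (use_eq (-1) 1 hS); ncring.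
apply: (le_trans (pD _ _)).
have h5 : p (kr (- r ^+ 4) * (S * (u * u * u * u))) <= r ^+ 4 * (p S * f (a, b) ^+ 4).
  apply: (le_trans (pR _ _)); rewrite normrN ger0_norm; last first.
    by rewrite -[4%N]/(2 * 2)%N exprM sqr_ge0.
  apply: ler_wpM2l; first by rewrite -[4%N]/(2 * 2)%N exprM sqr_ge0.
  by apply: (le_trans (pM _ _)); apply: ler_wpM2l.
apply: (le_trans (lerD (lexx _) h5)).
rewrite mulrCA -[X in X + _]mulr1 -mulrDr; apply: ler_wpM2r => //.
apply: addr_ge0 => //; apply: mulr_ge0; rewrite -[4%N]/(2 * 2)%N exprM; exact: sqr_ge0.
Qed.

(** An elementary substitute for Liouville's theorem. On a large square the
    function f + d |w|^2 with small d > 0 attains its maximum, and this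
    happens in the interior because f is small on the boundary. But the
    average over four points at distance r changes f by at least - O(r^4),
    while it increases d |w|^2 by d r^2. *)
Lemma no_everywhere_resolvent : False.
Proof.
have f0 := resolvent_gt0 (0, 0).
have pz := p_ge0 z.
pose L := 4 * p z + 8 * p 1 / f (0, 0) + 1.
have L1 : 8 * p 1 / f (0, 0) > 0 by rewrite divr_gt0 // mulr_gt0.
have L0 : 0 < L by rewrite /L; lra.
pose d := f (0, 0) / (8 * L ^+ 2).
have d0 : 0 < d by rewrite divr_gt0 // mulr_gt0 // exprn_gt0.
have dL : d * (8 * L ^+ 2) = f (0, 0).
  by rewrite /d divfK // gt_eqF // mulr_gt0 // exprn_gt0.
pose h (w : R * R) := f w + d * (w.1 * w.1 + w.2 * w.2).
have ch : continuous h.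
  move=> w; apply: cvgD; first exact: resolvent_continuous.
  apply: cvgM; first exact: cvg_cst.
  by apply: cvgD; apply: cvgM; (apply: cvg_fst || apply: cvg_snd).
pose K : set (R * R) := `[-L, L] `*` `[-L, L].
have K0 : K (0, 0) by split; rewrite /= in_itv /=; lra.
have cK : compact K by apply: compact_setX; exact: segment_compact.
have [| |[a b] /set_mem [/= ha hb] hm] := @compact_EVT_max _ _ h K _ cK.
- by exists (0, 0).
- by apply: continuous_subspaceT.
rewrite in_itv /= in ha; rewrite in_itv /= in hb.
have hmax a' b' : -L <= a' <= L -> -L <= b' <= L ->
    f (a', b') + d * (a' * a' + b' * b') <= f (a, b) + d * (a * a + b * b).
  by move=> h1 h2; apply: (hm (a', b')); apply/mem_set; split; rewrite /= in_itv.
have m0 := hmax 0 0 ltac:(lra) ltac:(lra).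
have [/andP[a1 a2] /andP[b1 b2]] : - L < a < L /\ - L < b < L.
  suff hs : ~ (L <= `|a| \/ L <= `|b|).
    rewrite -!ltr_norml; split; rewrite ltNge; apply/negP => hh; apply: hs; [by left|by right].
  move=> hs; have := @resolvent_small L (a, b) L0 _ hs.
  have Lz : 4 * p z <= L by rewrite /L; lra.
  move/(_ Lz) => sm.
  have s2 : 4 * p 1 / L <= f (0, 0) / 2.
    rewrite ler_pdivrMr // mulrAC ler_pdivlMr //.
    have e8 : 8 * p 1 / f (0, 0) * f (0, 0) = 8 * p 1 by rewrite divfK // gt_eqF.
    rewrite /L; nra.
  have aL : a * a <= L * L by nra.
  have bL : b * b <= L * L by nra.
  nra.
have [r [r0 [ra1 ra2] [rb1 rb2] rd]] : exists r : R, [/\ 0 < r, (r <= L - a /\ r <= a + L),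
   (r <= L - b /\ r <= b + L) & r ^+ 2 * f (a, b) ^+ 5 < d].
  have F0 : 0 <= f (a, b) ^+ 5 by apply: exprn_ge0; exact: p_ge0.
  pose e := d / (2 * (f (a, b) ^+ 5 + 1)).
  have F1 : 0 < 2 * (f (a, b) ^+ 5 + 1) by lra.
  have e0 : 0 < e by rewrite divr_gt0.
  have eE : e * (2 * (f (a, b) ^+ 5 + 1)) = d by rewrite divfK // gt_eqF.
  exists (Num.min (Num.min (L - a) (a + L)) (Num.min (Num.min (L - b) (b + L)) (Num.min 1 e))).
  set r := Num.min _ _.
  have : r <= r by [].
  rewrite {2}/r !le_min => /andP[/andP[h1 h2] /andP[/andP[h3 h4] /andP[h5 h6]]].
  have r0 : 0 < r by rewrite /r !lt_min; lra.
  split=> //; move: (f (a, b) ^+ 5) F0 F1 eE => F F0 F1 eE.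
  have : r ^+ 2 <= r by rewrite expr2 -[leRHS]mulr1; apply: ler_wpM2l => //; apply: ltW.
  nra.
have M := resolvent_mean a b r.
have q1 := hmax (a + r) b ltac:(lra) ltac:(lra).
have q2 := hmax (a - r) b ltac:(lra) ltac:(lra).
have q3 := hmax a (b + r) ltac:(lra) ltac:(lra).
have q4 := hmax a (b - r) ltac:(lra) ltac:(lra).
have F0 : 0 < f (a, b) := resolvent_gt0 (a, b).
move: (f (a + r, b)) (f (a - r, b)) (f (a, b + r)) (f (a, b - r)) M q1 q2 q3 q4.
move=> f1 f2 f3 f4 M q1 q2 q3 q4.
have S4 : f1 + f2 + f3 + f4 + 4 * d * r ^+ 2 <= 4 * f (a, b).
  by rewrite expr2; nra.
move: (f (a, b)) F0 S4 M rd => F F0 S4 M rd.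
have r2 : 0 < r ^+ 2 by rewrite exprn_gt0.
have G0 : 0 <= r ^+ 4 * F ^+ 4 by apply: mulr_ge0; apply: exprn_ge0; apply: ltW.
have dr : 0 < 4 * d * r ^+ 2 by apply: mulr_gt0 => //; apply: mulr_gt0.
have SG : (f1 + f2 + f3 + f4) * (r ^+ 4 * F ^+ 4) <= 4 * F * (r ^+ 4 * F ^+ 4).
  by apply: ler_wpM2r => //; lra.
have key : 4 * d * r ^+ 2 <= 4 * (r ^+ 2 * F ^+ 5) * r ^+ 2.
  rewrite (_ : 4 * (r ^+ 2 * F ^+ 5) * r ^+ 2 = 4 * F * (r ^+ 4 * F ^+ 4)); last by ring.
  rewrite mulrDr mulr1 in M; lra.
have : (r ^+ 2 * F ^+ 5) * r ^+ 2 < d * r ^+ 2 by rewrite (ltr_pM2r r2).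
lra.
Qed.

End Spectrum.

(** * Neumann series *)

Section RealNorm.
Local Open Scope classical_set_scope.
Variables (R : realType) (A : banachAlgType R[i]).
Local Notation B := (algOf A).

Definition rnorm (x : B) : R := complex.Re `|x : A|.

Lemma rnormE (x : B) : `|x : A| = (rnorm x)%:C%C.
Proof. exact/esym/RRe_real/normr_real. Qed.

Lemma rnorm_ge0 x : 0 <= rnorm x.
Proof. by rewrite -lecR -rnormE; exact: (@normr_ge0 _ A). Qed.

Lemma rnormD x y : rnorm (x + y) <= rnorm x + rnorm y.
Proof. by rewrite -lecR rmorphD /= -!rnormE; exact: (@ler_normD _ A). Qed.

Lemma rnormM x y : rnorm (x * y) <= rnorm x * rnorm y.
Proof. by rewrite -lecR rmorphM /= -!rnormE; exact: (@norm_bmul _ A). Qed.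

Lemma rnormN x : rnorm (- x) = rnorm x.
Proof. by rewrite /rnorm; congr complex.Re; exact: (@normrN _ A). Qed.

Lemma rnormZ c x : rnorm (c *: x) = complex.Re `|c| * rnorm x.
Proof.
have /= h : `|(c *: x : B) : A| = `|c| * `|x : A| by exact: (@normrZ _ A).
rewrite /rnorm h rnormE -[`|c| in LHS]RRe_real ?normr_real //.
by rewrite -rmorphM.
Qed.

(** The inverse is the sum of the powers of a. *)
Lemma neumann_left_inverse (a : B) : rnorm a < 1 -> exists b : B, b * (1 - a) = 1.
Proof.
move=> q1; set q := rnorm a in q1; have q0 : 0 <= q := rnorm_ge0 a.
pose s n : B := \sum_(i < n) a ^+ i.
have sS n : s n.+1 = s n + a ^+ n by rewrite /s big_ord_recr.
have pw n : rnorm (a ^+ n.+1) <= q ^+ n.+1.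
  elim: n => [|n ih]; first by rewrite !expr1.
  by rewrite exprS [leRHS]exprS; apply: (le_trans (rnormM _ _)); apply: ler_wpM2l.
have sdist N m : rnorm (s (N.+1 + m)%N - s N.+1) * (1 - q) <= q ^+ N.+1 - q ^+ (N.+1 + m).
  elim: m => [|m ih].
    by rewrite addn0 subrr -[0 : B](scale0r 0) rnormZ normr0 /= !mul0r subrr.
  rewrite addnS sS addrAC.
  have h1 := rnormD (s (N.+1 + m)%N - s N.+1) (a ^+ (N.+1 + m)).
  have h2 := pw (N + m)%N; rewrite -addSn in h2.
  rewrite [q ^+ (N.+1 + m).+1]exprS.
  have h3 := le_trans h1 (lerD (lexx _) h2).
  have q1' : 0 <= 1 - q by lra.
  have := ler_wpM2r q1' h3; rewrite mulrDl; lra.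
have qN (e : R) : 0 < e -> exists N, forall n, (N <= n)%N -> q ^+ n.+1 < e.
  move=> e0; have := @cvg_expr R q.
  rewrite ger0_norm // => /(_ q1) /cvgrPdist_lt /(_ e e0) [N _ hN].
  exists N => n Nn; have := hN n.+1 (leqW Nn).
  by rewrite /= sub0r normrN ger0_norm // exprn_ge0.
have scauchy : cauchy ((s : nat -> A) @ \oo).
  apply/cauchy_exP => e e0.
  have e0' : 0 < complex.Re e by case: e e0 => e1 e2; rewrite ltcE /= => /andP[].
  have eE : e = (complex.Re e)%:C%C by rewrite RRe_real // gtr0_real.
  have [|N hN] := qN (complex.Re e * (1 - q)); first by rewrite mulr_gt0 // subr_gt0.
  exists (s N.+1 : A); exists N.+1 => // n /= Nn.
  rewrite -ball_normE /= eE -[_ - _]/((s N.+1 - s n : B) : A) rnormE ltcR.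
  have h1 := sdist N (n - N.+1)%N; rewrite subnKC // in h1.
  have h2 := hN N (leqnn _).
  have h3 : 0 <= q ^+ n by rewrite exprn_ge0.
  rewrite -rnormN opprB -(ltr_pM2r (x := 1 - q)) ?subr_gt0 //; lra.
have [b sb] : exists b : A, (s : nat -> A) @ \oo --> b.
  have h := @cauchy_cvg A _ _ scauchy.
  exists (lim ((s : nat -> A) @ \oo)).
  exact: h.
pose b' : B := b.
exists b'.
have bs (e : R) : 0 < e -> exists N, forall n, (N <= n)%N -> rnorm (b' - s n) < e.
  move=> e0; move/cvgrPdist_lt : sb => /(_ e%:C%C); rewrite ltcR => /(_ e0) [N _ hN].
  by exists N => n Nn; have := hN n Nn; rewrite /= -[_ - _]/((b' - s n : B) : A) rnormE ltcR.
have tele n : s n * (1 - a) = 1 - a ^+ n.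
  elim: n => [|n ih]; first by rewrite /s big_ord0 mul0r expr0 subrr.
  by rewrite sS mulrDl ih exprSr; ncring.
suff z0 : rnorm (b' * (1 - a) - 1) = 0.
  apply/eqP; rewrite -subr_eq0; apply/eqP.
  by apply: (@normr0_eq0 _ A); rewrite rnormE z0.
apply/eqP; rewrite eq_le rnorm_ge0 andbT; apply/ler_addgt0Pr => e e0; rewrite add0r.
pose M := rnorm (1 - a) + 1; have M0 : 0 < M by rewrite ltr_wpDl ?rnorm_ge0.
have [|N1 h1] := bs (e / 2 / M); first by rewrite !divr_gt0.
have [|N2 h2] := qN (e / 2); first by rewrite divr_gt0.
pose n := maxn N1 N2.
have -> : b' * (1 - a) - 1 = (b' - s n.+1) * (1 - a) + (- a ^+ n.+1).
  rewrite mulrBl tele; ncring.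
apply: (le_trans (rnormD _ _)); rewrite rnormN.
have k1 := h1 n.+1 (leqW (leq_maxl _ _)).
have k2 := h2 n (leq_maxr _ _).
have k3 := le_trans (pw n) (ltW k2).
have k4 := rnormM (b' - s n.+1) (1 - a).
have k5 := rnorm_ge0 (b' - s n.+1).
rewrite ltr_pdivlMr // /M in k1.
have k6 := rnorm_ge0 (1 - a).
nra.
Qed.

End RealNorm.

(** * Maximal ideals and quotients *)

Section MaximalIdeal.
Local Open Scope classical_set_scope.
Variable A : pzRingType.

Definition maximal_ideal (N : A -> Prop) : Prop :=
  [/\ two_sided N, ~ N 1
    & forall J, two_sided J -> (forall x, N x -> J x) -> ~ J 1 -> forall x, J x -> N x].

Lemma exists_maximal_ideal (I : A -> Prop) : two_sided I -> ~ I 1 ->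
  exists2 N, maximal_ideal N & forall x, I x -> N x.
Proof.
move=> tI I1.
(* The ideal I is added to the members of P, so that the empty chain has an
   upper bound. *)
pose P : set (set A) := fun X => two_sided (fun x => I x \/ X x) /\ ~ (I 1 \/ X 1).
have [F FP totF|N [[tN N1] mN]] := @Zorn_bigcup A P.
  split; last first.
    by case=> // -[X FX X1]; have [_] := FP _ FX; apply; right.
  have [I0 ID IM] := tI; split.
  - by left.
  - move=> x y [Ix|[X FX Xx]] [Iy|[Y FY Yy]].
    + by left; apply: ID.
    + have [[_ h _] _] := FP _ FY; have [||hI|hY] := h x y; [by left|by right|by left|].
      by right; exists Y.
    + have [[_ h _] _] := FP _ FX; have [||hI|hY] := h x y; [by right|by left|by left|].
      by right; exists X.
    + have [XY|YX] := totF _ _ FX FY.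
        have [[_ h _] _] := FP _ FY.
        have [||hI|hY] := h x y; [by right; apply: XY|by right|by left|].
        by right; exists Y.
      have [[_ h _] _] := FP _ FX.
      have [||hI|hY] := h x y; [by right|by right; apply: YX|by left|].
      by right; exists X.
  - move=> a x b [Ix|[X FX Xx]]; first by left; apply: IM.
    have [[_ _ h] _] := FP _ FX; have [|hI|hX] := h a x b; [by right|by left|].
    by right; exists X.
exists (fun x => I x \/ N x); last by left.
split=> // J tJ NJ J1 x Jx; right; apply: contrapT => nNx.
have IJ y : I y -> J y by move=> Iy; apply: NJ; left.
apply: (mN J).
  by split=> [y Ny|JN]; [apply: NJ; right | apply/nNx/JN].
have e : (fun x => I x \/ J x) = J.
  by apply/funext => y; apply/propext; split=> [[/IJ|]|]; [| |right].
by split; [rewrite e | case=> // /IJ].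
Qed.

Lemma maximal_quotient_simple (N : A -> Prop) (Q : pzRingType) (pi : {rmorphism A -> Q}) :
  maximal_ideal N -> (forall q, exists a, pi a = q) ->
  (forall x, pi x = 0 <-> N x) -> simple_ring Q.
Proof.
move=> [tN N1 mN] pi_surj kN; split.
  by move=> e; apply: N1; apply/kN; rewrite rmorph1.
move=> q q0 I tI /(_ q erefl) Iq; have [x xq] := pi_surj q.
apply: contrapT => nI1; apply: q0; rewrite -xq; apply/kN.
have [I0 ID IM] := tI.
apply: (mN (fun x => I (pi x))); rewrite ?rmorph1 ?xq //.
- split=> [|a b ha hb|a b c hb]; rewrite ?rmorph0 ?rmorphD ?rmorphM //.
    exact: ID.
  exact: IM.
- by move=> a /kN ->.
Qed.

End MaximalIdeal.

Section Quotients.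
Variables (K : pzRingType) (A : algType K).

Lemma exists_quotient (N : A -> Prop) : two_sided N ->
  exists (Q : pzRingType) (pi : {rmorphism A -> Q}),
    (forall q, exists a, pi a = q) /\ (forall x, pi x = 0 <-> N x).
Proof.
move=> tN; have [N0 ND NM] := tN.
pose I : A -> bool := fun x => `[< N x >].
have zI : zmod_closed I.
  split=> [|x y /asboolP hx /asboolP hy]; apply/asboolP => //.
  exact: two_sided_sub.
have lI a x : x \in I -> a * x \in I.
  by move=> /asboolP hx; apply/asboolP; apply: two_sided_mull.
have rI a x : x \in I -> x * a \in I.
  by move=> /asboolP hx; apply/asboolP; apply: two_sided_mulr.
pose zc := GRing.isZmodClosed.Build A I zI.
pose tc := isTwoSidedIdeal.Build A I lI rI.
pose T : tideal A := HB.pack I zc tc.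
pose Q : pzRingType := alg_quot T.
pose p (x : A) : Q := (\pi_({ideal_quot T})%qT x).
have p_add : zmod_morphism p.
  move=> x y; apply: (addIr (p y)); rewrite subrK.
  by have := pi_qadd T (x - y) y; rewrite subrK => e; rewrite /p e.
have p_mul : monoid_morphism p by split=> // x y; rewrite /p -[RHS]/(qmul _ _) pi_qmul.
pose ma := GRing.isZmodMorphism.Build A Q p p_add.
pose mm := GRing.isMonoidMorphism.Build A Q p p_mul.
pose pm : {rmorphism A -> Q} := HB.pack p ma mm.
exists Q, pm; split; first by elim/alg_quotW => x; exists x.
move=> x; rewrite /= -[0](rmorph0 pm) /=; split.
  by move/alg_quot_piP; rewrite subr0 => /asboolP.
by move=> h; apply/alg_quot_piP; rewrite subr0; apply/asboolP.
Qed.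

Lemma has_quotient_iso_of_surjection (S : algType K) (g : A -> S) :
  {morph g : x y / x + y} -> {morph g : x y / x * y} -> g 1 = 1 ->
  (forall c x, g (c *: x) = c *: g x) -> (forall s, exists x, g x = s) ->
  has_quotient_iso A S.
Proof.
move=> gD gM g1 gZ gS.
have g0 : g 0 = 0 by apply: (addrI (g 0)); rewrite -gD !addr0.
have gN x : g (- x) = - g x by apply: (addrI (g x)); rewrite -gD !subrr.
pose I : A -> bool := fun x => g x == 0.
have zI : zmod_closed I.
  split=> [|x y /eqP hx /eqP hy]; apply/eqP => //.
  by rewrite gD gN hx hy subrr.
have lI a x : x \in I -> a * x \in I.
  by move=> /eqP hx; apply/eqP; rewrite gM hx mulr0.
have rI a x : x \in I -> x * a \in I.
  by move=> /eqP hx; apply/eqP; rewrite gM hx mul0r.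
pose zc := GRing.isZmodClosed.Build A I zI.
pose tc := isTwoSidedIdeal.Build A I lI rI.
pose T : tideal A := HB.pack I zc tc.
pose p (x : A) : alg_quot T := (\pi_({ideal_quot T})%qT x).
pose f (u : alg_quot T) : S := g (repr u).
have fp x : f (p x) = g x.
  have /eqP := alg_quot_repr T x; rewrite gD gN => /eqP.
  by rewrite subr_eq0 => /eqP.
have f_lin : linear f.
  move=> c; elim/alg_quotW => x; elim/alg_quotW => y.
  rewrite -[_ *: _]/(qscale _ _) pi_qscale -pi_qadd.
  by rewrite -!/(p _) !fp gD gZ.
pose ml := GRing.isLinear.Build K (alg_quot T) S *:%R f f_lin.
pose fl : {linear alg_quot T -> S} := HB.pack f ml.
exists T, fl; split.
  split; first by rewrite /= -[1]/(p 1) fp.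
  elim/alg_quotW => x; elim/alg_quotW => y.
  by rewrite -[_ * _ in LHS]/(qmul _ _) pi_qmul /= -!/(p _) !fp gM.
have [h hK] := choice gS.
exists (fun s => p (h s)) => /=; last by move=> s; rewrite fp hK.
elim/alg_quotW => x; rewrite -!/(p _) fp; apply/alg_quot_piP.
by apply/eqP; rewrite gD gN hK subrr.
Qed.

End Quotients.

(** * Simple quotients of Banach algebras *)

Section BanachQuotient.
Local Open Scope classical_set_scope.
Variables (R : realType) (A : banachAlgType R[i]).
Local Notation B := (algOf A).
Variables (Q : pzRingType) (pi : {rmorphism B -> Q}).
Hypothesis pi_surj : forall q, exists a, pi a = q.
Hypothesis sQ : simple_ring Q.

Definition qscalar (c : R[i]) : Q := pi (c%:A).

Lemma qscalar_zmod : zmod_morphism qscalar.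
Proof. by move=> a b; rewrite /qscalar scalerBl rmorphB. Qed.
Lemma qscalar_monoid : monoid_morphism qscalar.
Proof.
split=> [|a b]; first by rewrite /qscalar scale1r rmorph1.
by rewrite /qscalar -rmorphM -scalerAl mul1r scalerA.
Qed.
HB.instance Definition _ := GRing.isZmodMorphism.Build R[i] Q qscalar qscalar_zmod.
HB.instance Definition _ := GRing.isMonoidMorphism.Build R[i] Q qscalar qscalar_monoid.

Lemma qscalarD a b : qscalar (a + b) = qscalar a + qscalar b.
Proof. exact: rmorphD. Qed.
Lemma qscalarM a b : qscalar (a * b) = qscalar a * qscalar b.
Proof. exact: rmorphM. Qed.
Lemma qscalar1 : qscalar 1 = 1.
Proof. exact: rmorph1. Qed.

Lemma qscalarZ c a : pi (c *: a) = qscalar c * pi a.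
Proof. by rewrite /qscalar -rmorphM -scalerAl mul1r. Qed.

Lemma qscalar_central c : central (qscalar c).
Proof.
move=> q; have [a <-] := pi_surj q.
by rewrite -qscalarZ /qscalar -rmorphM -scalerAr mulr1.
Qed.

(** The quotient seminorm. *)
Definition qnorm (q : Q) : R := inf [set rnorm a | a in [set a | pi a = q]].

Lemma qnorm_has_inf q : has_inf [set rnorm a | a in [set a | pi a = q]].
Proof.
split; first by have [a ha] := pi_surj q; exists (rnorm a), a.
by exists 0 => _ [a _ <-]; apply: rnorm_ge0.
Qed.

Lemma qnorm_le a : qnorm (pi a) <= rnorm a.
Proof. by apply: ge_inf; [case: (qnorm_has_inf (pi a)) | exists a]. Qed.

Lemma qnorm_approx q e : 0 < e -> exists2 a, pi a = q & rnorm a < qnorm q + e.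
Proof.
by move=> e0; have [_ [a ha <-] h] := inf_adherent e0 (qnorm_has_inf q); exists a.
Qed.

Lemma qnorm_ge0 q : 0 <= qnorm q.
Proof.
apply: lb_le_inf; first by case: (qnorm_has_inf q).
by move=> _ [a _ <-]; apply: rnorm_ge0.
Qed.

(** An element at distance less than one from 1 has a left inverse, so it does
    not belong to the kernel. *)
Lemma qnorm1 : 0 < qnorm 1.
Proof.
apply: (lt_le_trans ltr01); apply: lb_le_inf; first by case: (qnorm_has_inf 1).
move=> _ [a ha <-]; rewrite leNgt; apply/negP => /neumann_left_inverse[b hb].
case: sQ => n1 _; apply: n1.
by rewrite -(rmorph1 pi) -hb rmorphM rmorphB rmorph1 ha subrr mulr0.
Qed.

Lemma qnormD x y : qnorm (x + y) <= qnorm x + qnorm y.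
Proof.
apply/ler_addgt0Pr => e e0.
have [|a <- ha] := @qnorm_approx x (e / 2); first by rewrite divr_gt0.
have [|b <- hb] := @qnorm_approx y (e / 2); first by rewrite divr_gt0.
rewrite -rmorphD; have h1 := qnorm_le (a + b); have h2 := rnormD a b; lra.
Qed.

Lemma qnormM x y : qnorm (x * y) <= qnorm x * qnorm y.
Proof.
apply/ler_addgt0Pr => e e0.
have x0 := qnorm_ge0 x; have y0 := qnorm_ge0 y.
pose d := Num.min 1 (e / (qnorm x + qnorm y + 1)).
have s0 : 0 < qnorm x + qnorm y + 1 by lra.
have d0 : 0 < d by rewrite lt_min ltr01 divr_gt0.
have d1 : d <= 1 by rewrite ge_min lexx.
have d2 : d * (qnorm x + qnorm y + 1) <= e.
  by rewrite -ler_pdivlMr // ge_min lexx orbT.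
have [a ax ha] := @qnorm_approx x d d0; have [b bx hb] := @qnorm_approx y d d0.
have h1 := qnorm_le (a * b); rewrite rmorphM ax bx in h1.
have h2 := rnormM a b; have a0 := rnorm_ge0 a; have b0 := rnorm_ge0 b.
have h3 : rnorm a * rnorm b <= (qnorm x + d) * (qnorm y + d).
  by apply: ler_pM => //; apply: ltW.
nra.
Qed.

Lemma qnormZ c x : qnorm (qscalar c * x) <= complex.Re `|c| * qnorm x.
Proof.
have c0 : 0 <= complex.Re `|c|.
  by rewrite -lecR RRe_real ?normr_real // normr_ge0.
apply/ler_addgt0Pr => e e0.
have [|a <- ha] := @qnorm_approx x (e / (complex.Re `|c| + 1)).
  by rewrite divr_gt0 // ltr_wpDl.
rewrite -qscalarZ; apply: (le_trans (qnorm_le _)); rewrite rnormZ.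
apply: (le_trans (ler_wpM2l c0 (ltW ha))); rewrite mulrDr lerD2l mulrA ler_pdivrMr ?ltr_wpDl //.
by rewrite mulrC; apply: ler_wpM2l; [apply: ltW | rewrite lerDl].
Qed.

(** The Gelfand-Mazur theorem for the center. Nonzero central elements of a
    simple ring are invertible, so a central element that is not a scalar
    would have a resolvent at every complex number. *)
Lemma simple_quotient_center z : central z -> exists c, z = qscalar c.
Proof.
move=> cz; apply: contrapT => hn.
have inv (w : R * R) : exists y, (z - qscalar (w.1%:C%C + w.2%:C%C * 'i%C)) * y = 1.
  apply: (simple_central_unit sQ).
    by apply: centralB => //; apply: qscalar_central.
  by move/eqP; rewrite subr_eq0 => /eqP h; apply: hn; exists (w.1%:C%C + w.2%:C%C * 'i%C).
have [y hy] := choice inv.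
have yr (w : R * R) : (z - qscalar w.1%:C%C - qscalar w.2%:C%C * qscalar 'i%C) * y w = 1.
  by rewrite -[RHS](hy w) qscalarD qscalarM opprD addrA.
apply: (@no_everywhere_resolvent R Q qscalar qnorm _ _ _ _ _ _ _ z y yr) => //.
- exact: qscalar_central.
- exact: qnorm_ge0.
- exact: qnormD.
- exact: qnormM.
- move=> a x; have := qnormZ a%:C%C x.
  by rewrite normc_def /= expr0n addr0 sqrtr_sqr.
- move=> x; have := qnormZ 'i%C x.
  by rewrite normc_def /= expr0n expr1n add0r sqrtr1 mul1r.
- exact: qnorm1.
- move=> w; rewrite -[RHS](yr w).
  suff c : central (z - qscalar w.1%:C%C - qscalar w.2%:C%C * qscalar 'i%C) by rewrite c.
  apply: centralB; last by apply: centralM; apply: qscalar_central.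
  by apply: centralB => //; apply: qscalar_central.
Qed.

Lemma qscalar_inj : injective qscalar.
Proof.
move=> a b ab; have h : qscalar (a - b) * 1 = 0 by rewrite mulr1 qscalar_zmod ab subrr.
by case/scalar_reg: h => [/eqP|/(proj1 sQ)//]; rewrite subr_eq0 => /eqP.
Qed.

Lemma scalar_ring_quotient_iso : scalar_ring qscalar -> has_quotient_iso B R[i]^o.
Proof.
move=> h; have [g hg] := choice (fun x : B => h (pi x)).
apply: (@has_quotient_iso_of_surjection _ B R[i]^o g).
- by move=> x y; apply: qscalar_inj; rewrite qscalarD -!hg rmorphD.
- by move=> x y; apply: qscalar_inj; rewrite qscalarM -!hg rmorphM.
- by apply: qscalar_inj; rewrite -hg qscalar1 rmorph1.
- by move=> c x; apply: qscalar_inj; rewrite [RHS]qscalarM -!hg qscalarZ.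
- move=> s; have [x hx] := pi_surj (qscalar s); exists x.
  by apply: qscalar_inj; rewrite -hg.
Qed.

Lemma matrix2_ring_quotient_iso : matrix2_ring qscalar -> has_quotient_iso B 'M[R[i]]_2.
Proof.
case=> T [TD TM T1 Ts [Ti Tsurj]].
have [g hg] := choice (fun x : B => Tsurj (pi x)).
apply: (@has_quotient_iso_of_surjection _ B 'M[R[i]]_2 g).
- by move=> x y; apply: Ti; rewrite TD !hg rmorphD.
- by move=> x y; apply: Ti; rewrite TM !hg rmorphM.
- by apply: Ti; rewrite hg T1 rmorph1.
- by move=> c x; apply: Ti; rewrite -mul_scalar_mx [c%:M *m _]/(c%:M * g x) TM Ts !hg qscalarZ.
- by move=> s; have [x hx] := pi_surj (T s); exists x; apply: Ti; rewrite hg.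
Qed.

End BanachQuotient.

(** * Additive maps whose squares commute *)

Section Semisimple.
Local Open Scope classical_set_scope.

(** If aBa = 0 and a is not in the maximal left ideal M, then 1 = m + b a with
    m in M, and a = a m + a b a = a m is in M. *)
Lemma semisimple_semiprime (A : nzRingType) : semisimple A -> semiprime A.
Proof.
move=> ss a ha; have : @jacobson_radical A a; last by move: ss; rewrite /semisimple => ->.
move=> M [[M0 MD MM] M1 Mmax]; apply: contrapT => nMa.
pose L : set A := fun x => exists2 m, M m & exists b, x = m + b * a.
have lL : left_ideal L.
  split.
  - by exists 0 => //; exists 0; rewrite mul0r addr0.
  - move=> _ _ [m hm [b ->]] [m' hm' [b' ->]]; exists (m + m'); first exact: MD.
    by exists (b + b'); rewrite mulrDl addrACA.
  - move=> c _ [m hm [b ->]]; exists (c * m); first exact: MM.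
    by exists (c * b); rewrite mulrDr mulrA.
have ML : M `<=` L by move=> m hm; exists m => //; exists 0; rewrite mul0r addr0.
have [LM|LT] := Mmax L lL ML.
  by apply: nMa; rewrite -LM; exists 0 => //; exists 1; rewrite mul1r add0r.
have [m hm [b e]] : L 1 by rewrite LT.
apply: nMa; rewrite (_ : a = a * m); first exact: MM.
by rewrite -[LHS]mulr1 e mulrDr mulrA ha addr0.
Qed.

End Semisimple.

Section BanachFacts.
Variables (R : realType) (A : banachAlgType R[i]).
Local Notation B := (algOf A).
Hypothesis noC : ~ has_quotient_iso B (R[i])^o.
Hypothesis noM2 : ~ has_quotient_iso B 'M[R[i]]_2.

Definition bhalf : B := (2^-1)%:A.

Lemma bhalf2 : bhalf + bhalf = 1.
Proof.
rewrite /bhalf -scalerDl -[in LHS](mulr1 2^-1) -mulrDr -[1 + 1]/(2%:R).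
by rewrite mulVf ?pnatr_eq0 // scale1r.
Qed.

Lemma btorsion_free n (x : B) : x *+ n.+1 = 0 -> x = 0.
Proof.
move=> h; have : (n.+1%:R : R[i])^-1 *: (x *+ n.+1) = 0 by rewrite h scaler0.
by rewrite -[x *+ n.+1]scaler_nat scalerA mulVf ?pnatr_eq0 // scale1r.
Qed.

Lemma no_degenerate_quotient (Q : pzRingType) (pi : {rmorphism B -> Q}) :
  (forall q, exists a, pi a = q) -> simple_ring Q ->
  ~ (scalar_ring (qscalar pi) \/ matrix2_ring (qscalar pi)).
Proof.
move=> ps sQ [/scalar_ring_quotient_iso|/matrix2_ring_quotient_iso] h.
  by apply: noC; apply: h.
by apply: noM2; apply: h.
Qed.

(** Otherwise the defects are contained in a maximal ideal. In the simple
    quotient all defects vanish, so each element is quadratic over the center,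
    which consists of scalars; such a quotient has dimension one or four. *)
Lemma banach_defects_generate : generates_unit (@is_quad_defect B).
Proof.
move=> I tI hI; apply: contrapT => I1.
have [N mN IN] := exists_maximal_ideal tI I1.
have [Q [pi [ps kp]]] := exists_quotient (let: And3 h _ _ := mN in h).
have sQ := maximal_quotient_simple mN ps kp.
apply: (no_degenerate_quotient ps sQ).
apply: (quadratic_simple_ring sQ (qscalar_central ps)) => t.
have dz w u v : quad_defect t w u v = 0.
  have [t' <-] := ps t; have [w' <-] := ps w; have [u' <-] := ps u; have [v' <-] := ps v.
  rewrite (_ : quad_defect _ _ _ _ = pi (quad_defect t' w' u' v')).
    by apply/kp/IN/hI; exists t', w', u', v'.
  by rewrite /quad_defect !(rmorphB, rmorphM).
case: (quad_defect0 sQ dz) => [/(simple_quotient_center ps sQ)|]; first by left.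
move=> [a [b [ca cb h]]].
have [a' ea] := simple_quotient_center ps sQ ca.
have [b' eb] := simple_quotient_center ps sQ cb.
by right; exists a', b'; rewrite h ea eb.
Qed.

(** A proper Jordan ideal is contained in a maximal two-sided ideal N, and
    modulo N the Jordan products of double commutators commute with all
    commutators. So they are central, and the quotient has dimension one or
    four. *)
Lemma jordan_ideal_identity (W : B -> Prop) : jordan_ideal W ->
  (forall x a b y c d u v : B,
    W (lie (jord (lie x (lie a b)) (lie y (lie c d))) (lie u v))) -> W 1.
Proof.
move=> jW hW; apply: contrapT => W1.
have I1 : ~ ideal_core W 1 by move/(_ 1 1); rewrite !mulr1.
have [N mN IN] := exists_maximal_ideal (ideal_core_two_sided jW) I1.
have [Q [pi [ps kp]]] := exists_quotient (let: And3 h _ _ := mN in h).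
have sQ := maximal_quotient_simple mN ps kp.
have ker : forall w, W w -> pi w = 0.
  by apply: (jordan_ideal_kernel bhalf2 jW sQ ps) => x /IN /kp.
apply: (no_degenerate_quotient ps sQ).
apply: (double_commutator_simple_ring sQ (qscalar_central ps) (simple_quotient_center ps sQ)).
move=> x a b y c d; apply: (central_of_lie_lie sQ) => u v.
have [x' <-] := ps x; have [a' <-] := ps a; have [b' <-] := ps b.
have [y' <-] := ps y; have [c' <-] := ps c; have [d' <-] := ps d.
have [u' <-] := ps u; have [v' <-] := ps v.
have := ker _ (hW x' a' b' y' c' d' u' v').
by rewrite !(rmorphB, rmorphD, rmorphM).
Qed.

End BanachFacts.

Theorem theorem2p7 (R : realType) (A B : banachAlgType (complex R))
    (Phi : {additive algOf A -> algOf B})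
    (Phi_surj : forall b : algOf B, exists a : algOf A, Phi a = b)
    (Phi_comm : forall x : algOf A, commutator (Phi (x ^+ 2)) (Phi x) = 0)
    (A_noC : ~ has_quotient_iso (algOf A) (complex R)^o)
    (A_noM2 : ~ has_quotient_iso (algOf A) 'M[complex R]_2)
    (B_noC : ~ has_quotient_iso (algOf B) (complex R)^o)
    (B_noM2 : ~ has_quotient_iso (algOf B) 'M[complex R]_2)
    (B_ss : semisimple (algOf B)) :
  exists (Psi : algOf A -> algOf B) (lambda : algOf B)
         (zeta : {additive algOf A -> algOf B}),
    [/\ jordan_homomorphism Psi /\ (forall b : algOf B, exists a : algOf A, Psi a = b),
        ring_center lambda /\ (exists mu, lambda * mu = 1 /\ mu * lambda = 1),
        forall x : algOf A, ring_center (zeta x),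
        forall x : algOf A, Phi x = lambda * Psi x + zeta x
      & direct_sum_hom_antihom Psi].
Proof.
have sB := semisimple_semiprime B_ss.
have HB := banach_defects_generate B_noC B_noM2.
pose hf := bhalf B; have hf2 : hf + hf = 1 := bhalf2 B.
have PhiD (x y : algOf A) : Phi (x + y) = Phi x + Phi y := raddfD Phi x y.
pose T (x y : algOf A) := Phi (jord x y).
have TC x y : T x y = T y x by rewrite /T addrC.
have TD x y z : T (x + y) z = T x z + T y z.
  by rewrite /T -PhiD; congr (Phi _); ncring.
have Tcomm x y z : lie (T x y) (Phi z) + lie (T y z) (Phi x) + lie (T z x) (Phi y) = 0.
  have c3 (a : algOf A) : lie (Phi (a * a)) (Phi a) = 0 by have := Phi_comm a; rewrite expr2.
  have q2 (a b : algOf A) : Phi ((a + b) * (a + b)) = Phi (a * a) + T a b + Phi (b * b).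
    by rewrite /T -!PhiD; congr (Phi _); ncring.
  (* Full polarization of the cubic map a |-> [Phi (a a), Phi a]. *)
  have e1 := c3 (x + y + z); have e2 := c3 (x + y); have e3 := c3 (y + z); have e4 := c3 (x + z).
  rewrite !q2 !TD !PhiD in e1 e2 e3 e4.
  rewrite (TC z x).
  apply: (use_eq 1 1 e1).
  apply: (use_eq (-1) 1 e2).
  apply: (use_eq (-1) 1 e3).
  apply: (use_eq (-1) 1 e4).
  apply: (use_eq 1 1 (c3 x)).
  apply: (use_eq 1 1 (c3 y)).
  apply: (use_eq 1 1 (c3 z)).
  ncring.
have [l [mu [cl cmu form]]] := commuting_form hf2 Phi_surj HB sB TC TD Tcomm.
(* If l lies in a maximal ideal N, then Phi modulo N has a degenerate form: it
   satisfies the hypotheses of the section on such forms, and the degenerate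
   elements are a proper Jordan ideal of A whose existence contradicts the
   assumptions on the quotients of A. *)
have [w lw] : exists w, l * w = 1.
  pose I (x : algOf B) := exists w, l * w = x.
  have tI : two_sided I.
    split; first by exists 0; rewrite mulr0.
      by move=> _ _ [u <-] [v <-]; exists (u + v); rewrite mulrDr.
    by move=> a _ b [u <-]; exists (a * u * b); rewrite !mulrA cl.
  apply: contrapT => I1.
  have [N mN IN] := exists_maximal_ideal tI I1.
  have [C [pi [ps kp]]] := exists_quotient (let: And3 h _ _ := mN in h).
  have sC := maximal_quotient_simple mN ps kp.
  pose phi : {additive algOf A -> C} := [the {additive algOf A -> C} of pi \o Phi].
  pose nu : {additive algOf A -> C} := [the {additive algOf A -> C} of pi \o mu].
  have cpi z : central z -> central (pi z).
    by move=> cz c; have [b <-] := ps c; rewrite -!rmorphM cz.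
  have hfC : pi hf + pi hf = 1 by rewrite -rmorphD hf2 rmorph1.
  have phi_surj c : exists a, phi a = c.
    by have [b <-] := ps c; have [a <-] := Phi_surj b; exists a.
  have ncC : ~ forall x y : C, x * y = y * x.
    move=> cC; case: mN => tN N1 _; apply: N1; apply: (commutators_generate HB) => //.
    by move=> _ [x [y ->]]; apply/kp; rewrite rmorphB !rmorphM cC subrr.
  have nu_central x : central (nu x) := cpi _ (cmu x).
  have nu_form x y : central (phi (jord x y) - (nu x * phi y + nu y * phi x)).
    have l0 : pi l = 0 by apply/kp/IN; exists 1; rewrite mulr1.
    have := cpi _ (form x y).
    by rewrite rmorphB !rmorphD !rmorphM l0 mul0r add0r.
  apply: (degenerate_proper hfC ncC phi_surj nu_central nu_form).
  apply: (jordan_ideal_identity A_noC A_noM2).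
    exact: (degenerate_jordan_ideal hfC sC ncC phi_surj nu_central nu_form).
  exact: (degenerate_identity hfC sC ncC phi_surj nu_central nu_form).
have cw := central_inverse cl lw.
have ch := half_central hf2.
(* Completing the square in Phi (x x) = l (Phi x)^2 + mu x Phi x + central. *)
pose P (x : algOf A) := l * Phi x + hf * mu x.
have P_zmod : zmod_morphism P.
  by move=> x y; rewrite /P !raddfB /=; ncring.
pose Pm := GRing.isZmodMorphism.Build (algOf A) (algOf B) P P_zmod.
pose Psi : {additive algOf A -> algOf B} := HB.pack P Pm.
have dense b : exists x, central (b - Psi x).
  have [x hx] := Phi_surj (w * b); exists x.
  rewrite /Psi /= /P hx mulrA lw mul1r opprD addrA subrr sub0r.
  by apply/centralN/centralM.
have eps_central x y : central (eps Psi x y).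
  rewrite /eps /Psi /= /P.
  have cyx := cmu y (Phi x); have cxy := cmu x (Phi y).
  have clx := cl (Phi x); have cly := cl (Phi y).
  have clmx := cl (mu x); have clmy := cl (mu y); have chl := ch l.
  have chx := ch (Phi x); have chy := ch (Phi y).
  have chmx := ch (mu x); have chmy := ch (mu y).
  have cf : central (Phi (jord x y) - _) := form x y.
  have cmm := cmu (jord x y); have cx := cmu x; have cy := cmu y.
  move: (Phi x) (Phi y) (mu x) (mu y) (Phi (jord x y)) (mu (jord x y))
    cyx cxy clx cly clmx clmy chx chy chmx chmy cf cmm cx cy.
  move=> p q m n s t cyx cxy clx cly clmx clmy chx chy chmx chmy cf cmm cx cy.
  rewrite (_ : _ - _ = l * (s - (l * jord p q + m * q + n * p)) + hf * t
    - hf * hf * jord m n).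
    apply: centralB; last first.
      exact: (centralM (centralM ch ch) (centralD (centralM cx cy) (centralM cy cx))).
    exact: (centralD (centralM cl cf) (centralM ch cmm)).
  apply: (use_eq l q clx).
  apply: (use_eq l p cly).
  apply: (use_eq l n chx).
  apply: (use_eq l m chy).
  apply: (use_eq (l * hf) 1 cyx).
  apply: (use_eq (l * hf) 1 cxy).
  apply: (use_eq hf p clmy).
  apply: (use_eq hf q clmx).
  apply: (use_eq (-1) (n * p) chl).
  apply: (use_eq (-1) (m * q) chl).
  apply: (use_eq (- l) (n * p) hf2).
  apply: (use_eq (- l) (m * q) hf2).
  apply: (use_eq hf n chmx).
  apply: (use_eq hf m chmy).
  ncring.
have PJ x y : Psi (jord x y) = jord (Psi x) (Psi y).
  apply/eqP; rewrite -subr_eq0; apply/eqP.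
  exact: (eps_zero (@btorsion_free R B) HB sB dense eps_central x y).
have [e [ce ee eh ea]] := jordan_direct_sum (@btorsion_free R B) HB sB dense PJ.
have cz x : central (- (w * (hf * mu x))).
  by apply/centralN/centralM => //; apply: centralM.
have z_zmod : zmod_morphism (fun x => - (w * (hf * mu x))).
  by move=> x y; rewrite raddfB /=; ncring.
pose zm := GRing.isZmodMorphism.Build (algOf A) (algOf B) _ z_zmod.
pose zeta : {additive algOf A -> algOf B} := HB.pack (fun x => - (w * (hf * mu x))) zm.
exists Psi, w, zeta; split.
- split; first by split; [exact: raddfD | exact: PJ].
  have c1e : central (1 - e) by apply: centralB => //; apply: central1.
  have [e0 e0'] : e * (1 - e) = 0 /\ (1 - e) * e = 0.
    by rewrite mulrBr mulrBl mulr1 mul1r ee subrr.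
  move=> b.
  have [|x hx] := @direct_sum_half_surj _ _ Psi HB dense ( *%R)
      e (1 - e) ce c1e _ e0 eh ea b.
    by rewrite addrC subrK.
  have [|||x' hx'] := @direct_sum_half_surj _ _ Psi HB dense (fun x y => y * x)
      (1 - e) e c1e ce _ e0' _ _ b.
  - by rewrite subrK.
  - by move=> u v; apply: ea.
  - by move=> u v; apply: eh.
  by exists (x + x'); rewrite raddfD hx hx' /= -mulrDl addrC subrK mul1r.
- by split=> //; exists l; rewrite cw lw.
- exact: cz.
- move=> x; rewrite /Psi /= /P.
  apply: (use_eq (-1) (Phi x) (cw l)).
  apply: (use_eq (-1) (Phi x) lw).
  ncring.
- by exists e; split.
Qed.
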